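(* Let $0<\varepsilon\le1$, $0<\mu\le1$ and $C>0$ be constants. Let $A=(a_{ij})$ be an $n\times n$ real matrix with $\rho_b^{(\mu)}(A)\ge n^{-C}$. Then there exist index sets $I_0,J_0\subseteq\{1,\dots,n\}$ of size $O_{C,\varepsilon}(1)$ and index sets $I,J$ of size $n-3n^{\varepsilon}$ with $I\cap I_0=\emptyset$, $J\cap J_0=\emptyset$, nonzero integers $k,l$ and integers $k_{ij}$ ($i\in I$, $j\in I_0$), $l_{ij}$ ($i\in J_0$, $j\in J$), all of absolute value at most $n^{O_{C,\varepsilon,\mu}(1)}$, such that, with $L$ and $R$ the $n\times n$ matrices defined below, the matrix $A'=LAR$ has the following properties: (i) for each $i\in I$ there exist a set of $n-n^{\varepsilon}$ entries of the $i$-th row of $A'$ and a proper symmetric GAP $Q_i$ of rank $O_{C,\varepsilon,\mu}(1)$ and size $n^{O_{C,\varepsilon,\mu}(1)}$ containing all of them; (ii) for each $j\in J$ there exist a set of $n-n^{\varepsilon}$ entries of the $j$-th column of $A'$ and a proper symmetric GAP $P_j$ of rank $O_{C,\varepsilon,\mu}(1)$ and size $n^{O_{C,\varepsilon,\mu}(1)}$ containing all of them. Here $L$ is defined by: for $i\in I$, $L(ij)=k_{ij}$ if $j\in I_0$, $L(ii)=k$, and $L(ij)=0$ otherwise; for $i\notin I$, the $i$-th row of $L$ is the $i$-th standard basis vector. And $R$ is defined by: for $j\in J$, $R(ij)=l_{ij}$ if $i\in J_0$, $R(jj)=l$, and $R(ij)=0$ otherwise; for $j\notin J$, the $j$-th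 column of $R$ is the $j$-th standard basis vector.
   Context: For $0<\mu\le1$, $\eta^{\mu}$ takes values $1$ and $-1$ with probability $\mu/2$ each and $0$ with probability $1-\mu$; $\rho_b^{(\mu)}(A):=\sup_{a\in\mathbb{R}}\mathbb{P}(\sum_{i,j}a_{ij}x_iy_j=a)$ where $x_1,\dots,x_n,y_1,\dots,y_n$ are independent copies of $\eta^{\mu}$. A symmetric GAP of rank $r$ is $\{m_1g_1+\dots+m_rg_r: m_h\in\mathbb{Z}, |m_h|\le N_h\}$ with real $g_h$, nonnegative integers $N_h$; proper means unique representation; size means cardinality. $O_{C,\varepsilon,\mu}(1)$ denotes a quantity bounded by a constant depending only on the subscripts; asymptotics are as $n\to\infty$. *)

(* Defs.v *)
From HB Require Import structures.
From mathcomp Require Import all_boot all_order all_algebra.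
From mathcomp Require Import all_classical all_reals all_analysis.
Import Order.TTheory GRing.Theory Num.Theory.
Import numFieldNormedType.Exports.

Set Implicit Arguments.
Unset Strict Implicit.
Unset Printing Implicit Defensive.

Local Open Scope classical_set_scope.
Local Open Scope card_scope.
Local Open Scope ring_scope.

(* With [0 <= t], this is the ceiling of [n - t], cut off at [0] when [n < t]:
   the size meant by "n - t" when t is not an integer. *)
Definition size_minus (R : realType) (n : nat) (t : R) : nat :=
  (n - Num.truncn t)%N.

Definition eta_law (R : realType) (mu : R) d (T : measurableType d)
    (P : probability T R) (X : {RV P >-> R}) : Prop :=
  [/\ P (X @^-1` [set 1]) = (mu / 2)%:E,
      P (X @^-1` [set -1]) = (mu / 2)%:E &
      P (X @^-1` [set 0]) = (1 - mu)%:E].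

(* It suffices to ask for the product rule over the whole finite family:
   taking [B i = setT] gives it for every subfamily. *)
Definition mutually_independent (R : realType) d (T : measurableType d)
    (P : probability T R) (I : finType) (X : I -> {RV P >-> R}) : Prop :=
  forall B : I -> set R, (forall i, measurable (B i)) ->
    P (\bigcap_(i in [set: I]) (X i @^-1` B i)) =
    (\prod_(i : I) P (X i @^-1` B i))%E.

Definition iid_eta (R : realType) (mu : R) d (T : measurableType d)
    (P : probability T R) n (x y : 'I_n -> {RV P >-> R}) : Prop :=
  [/\ forall i, eta_law mu (x i), forall j, eta_law mu (y j) &
      mutually_independent
        (fun s : 'I_n + 'I_n => match s with inl i => x i | inr j => y j end)].

Definition rho_b (R : realType) d (T : measurableType d)
    (P : probability T R) n (x y : 'I_n -> {RV P >-> R})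
    (A : 'M[R]_n) : \bar R :=
  ereal_sup (range (fun a : R =>
    P [set w | \sum_(i < n) \sum_(j < n) A i j * x i w * y j w = a])).

(* The symmetric GAP { sum_h m_h g_h : |m_h| <= N_h }, given by its data, since
   its rank and properness depend on the presentation. *)
Record symGAP (R : realType) := SymGAP {
  gap_rank : nat;
  gap_gen : 'I_gap_rank -> R;
  gap_dim : 'I_gap_rank -> nat
}.

Section SymGAP.
Variables (R : realType) (Q : symGAP R).

Definition gap_box : set ('I_(gap_rank Q) -> int) :=
  [set m | forall h, (`|m h| <= gap_dim h)%N].

Definition gap_eval (m : 'I_(gap_rank Q) -> int) : R :=
  \sum_h (m h)%:~R * gap_gen h.

Definition gap_set : set R := gap_eval @` gap_box.

Definition gap_proper : Prop := set_inj gap_box gap_eval.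

End SymGAP.

(* [K] bounds both the rank and the exponent of the size; [B #<= `I_m] says
   that [B] has at most [m] elements. *)
Definition in_small_proper_gap (R : realType) (K n : nat) (B : set R) : Prop :=
  exists Q : symGAP R,
    [/\ gap_proper Q, (gap_rank Q <= K)%N,
        gap_set Q #<= `I_(n ^ K) & B `<=` gap_set Q].

Definition Lmx (R : realType) n (I I0 : {set 'I_n}) (k : int)
    (kk : 'I_n -> 'I_n -> int) : 'M[R]_n :=
  \matrix_(i, j)
    if i \in I then
      if j \in I0 then (kk i j)%:~R else if j == i then k%:~R else 0
    else (i == j)%:R.

Definition Rmx (R : realType) n (J J0 : {set 'I_n}) (l : int)
    (ll : 'I_n -> 'I_n -> int) : 'M[R]_n :=
  \matrix_(i, j)
    if j \in J then
      if i \in J0 then (ll i j)%:~R else if i == j then l%:~R else 0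
    else (i == j)%:R.

(* Main.v *)
Require Import Defs.
From HB Require Import structures.
From mathcomp Require Import all_boot all_order all_algebra.
From mathcomp Require Import all_classical all_reals all_analysis.
From mathcomp Require Import ring lra zify.
Import Order.TTheory GRing.Theory Num.Theory.
Import numFieldNormedType.Exports.

Set Implicit Arguments.
Unset Strict Implicit.
Unset Printing Implicit Defensive.

(* Write rho(v; a) for the probability that the random walk with steps [eta v_j]
   ends at [-a].

   Concentration.  By Cauchy-Schwarz, in a walk in which every step occurs twice,
   a block of 2^j steps can be replaced by 2^j copies of one of them without
   lowering the probability of return.

   Inverse theorem.  Let rho(b; a) >= m^-c with m = 2^s.  As long as at least m
   of the remaining b_j satisfy no integer relation of height N_d with the
   vectors w_1, ..., w_d chosen so far, concentrate a block of m of them on a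
   single w_(d+1).  Each stage multiplies the return probability by at most a
   fixed negative power of m, so there are O(c) stages.  Afterwards most b_j are
   rational combinations u_j of the w_h, of height a small power of the level up
   to which the w_h are independent, so that the walk may be run in Q^d instead.
   There, as long as m of the u_j have order p >= 3 modulo (1/q) Z^d, concentrate
   on one of them and replace q by p q; this costs a factor p^(-1/E) in the return
   probability, whence q stays polynomial in m, and in the end 2 q is a common
   denominator of most u_j.  (Order 2 has to be excluded: for mu = 1 the parity
   of the walk is deterministic.)

   Bilinear forms.  Conditionally on x, the inverse theorem in y gives relations
   between the entries of x^T A.  By the pigeonhole principle a proportion
   n^-O(1) of the x share the basis and the denominator and, for most j, the
   numerators; so a fixed combination of the columns of A is orthogonal to x with
   probability at least n^-O(1), and the inverse theorem in x puts most of its entries in a GAP.  The rows are treated by transposing;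
   multiplication by L (resp. R) only adds the O(1) entries with index in I_0
   (resp. J_0) as new generators. *)

(** * Lazy random walks and concentration on repeated steps *)

Local Open Scope ring_scope.

Section Walk.
Variables (R : realFieldType) (mu : R).

Section OneGroup.
Variable V : zmodType.
Implicit Types (f g : V -> R) (s t : seq V) (a x v : V).

(** Expectation of [f] at the endpoint of the walk started at [a], where the step along [v] is [v]
    or [-v] with probability [mu / 2] each and 0 otherwise. The recursion makes sense in any abelian
    group and involves no probability space. *)
Fixpoint walk f s a : R :=
  if s is v :: s' then
    (1 - mu) * walk f s' a + mu / 2 * (walk f s' (a + v) + walk f s' (a - v))
  else f a.

Definition rho s a : R := walk (fun x => (x == 0)%:R) s a.

Lemma walk_cat f s t a : walk f (s ++ t) a = walk (walk f t) s a.
Proof. by elim: s a => //= v s IH a; rewrite !IH. Qed.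

Lemma eq_walk f g s : f =1 g -> walk f s =1 walk g s.
Proof. by move=> fg; elim: s => //= v s IH a; rewrite !IH. Qed.

Lemma walk_consC f v s a : walk f (v :: s) a = walk (walk f [:: v]) s a.
Proof.
elim: s a => [//|w s IH] a; rewrite [RHS]/= -!IH /=.
rewrite (addrAC a v w) (addrAC a v (- w)) (addrAC a (- v) w).
rewrite (addrAC a (- v) (- w)); ring.
Qed.

Lemma walk_catC f s t a : walk f (s ++ t) a = walk f (t ++ s) a.
Proof.
elim: s a => [|v s IH] a; first by rewrite cats0.
rewrite [LHS]/= !IH -/(walk f (v :: t ++ s) a) walk_consC !walk_cat.
by apply: eq_walk => x; rewrite walk_consC.
Qed.

Lemma walk_perm f s t : perm_eq s t -> walk f s =1 walk f t.
Proof.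
move=> st; apply: (catCA_perm_ind (P := fun s' => walk f s' =1 walk f t) _ _ (fun=> erefl)).
  move=> s1 s2 s3 E a; rewrite -E !catA walk_cat (walk_cat _ (s1 ++ s2)).
  exact: walk_catC.
by rewrite perm_sym.
Qed.

Lemma rho_perm s t : perm_eq s t -> rho s =1 rho t.
Proof. exact: walk_perm. Qed.

Lemma rhoN s a : rho s (- a) = rho s a.
Proof.
elim: s a => [|v s IH] a; rewrite /rho /=; first by rewrite oppr_eq0.
rewrite -!/(rho s _) IH -(IH (a + v)) -(IH (a - v)) opprD opprB.
by rewrite [- a - v]addrC [v - a]addrC; ring.
Qed.

(** Weighted endpoints of the walk from 0; an endpoint is listed once for each pattern of moves
    leading to it. *)
Fixpoint law s : seq (R * V) :=
  if s is v :: s' then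
    [seq ((1 - mu) * p.1, p.2) | p <- law s'] ++
    [seq (mu / 2 * p.1, p.2 + v) | p <- law s'] ++
    [seq (mu / 2 * p.1, p.2 - v) | p <- law s']
  else [:: (1, 0)].

Lemma walk_law f s a : walk f s a = \sum_(p <- law s) p.1 * f (a + p.2).
Proof.
elim: s a => [|v s IH] a /=; first by rewrite big_seq1 mul1r addr0.
rewrite !big_cat !big_map /= !IH mulrDr !mulr_sumr.
congr (_ + (_ + _)); apply: eq_bigr => p _; rewrite mulrA //.
  by rewrite addrAC addrA.
by rewrite addrAC addrA.
Qed.

Hypotheses (mu_ge0 : 0 <= mu) (mu_le1 : mu <= 1).

Let mu2_ge0 : 0 <= mu / 2. Proof. by rewrite divr_ge0 ?ler0n. Qed.
Let mu1_ge0 : 0 <= 1 - mu. Proof. by rewrite subr_ge0. Qed.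

(* [P k] is an invariant of the points reached after [k] steps. *)
Lemma walk_le_in (P : nat -> V -> Prop) f g s a :
    (forall k x v, P k x -> v \in s -> [/\ P k.+1 x, P k.+1 (x + v) & P k.+1 (x - v)]) ->
    (forall x, P (size s) x -> f x <= g x) -> P 0%N a ->
  walk f s a <= walk g s a.
Proof.
move=> Pstep fg; rewrite -[size s]/(0 + size s)%N in fg.
elim: s 0%N a fg Pstep => [|v s IH] k a /= fg Pstep Pa.
  by apply: fg; rewrite addn0.
have [P1 P2 P3] := Pstep _ _ v Pa (mem_head _ _).
have H x : P k.+1 x -> walk f s x <= walk g s x.
  apply: IH => [y|j y w Py ws]; first by rewrite addSnnS; exact: fg.
  by apply: Pstep => //; rewrite inE ws orbT.
by apply: lerD; apply: ler_wpM2l => //; [|apply: lerD]; apply: H.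
Qed.

Lemma walk_le f g s : (forall x, f x <= g x) -> forall a, walk f s a <= walk g s a.
Proof. by move=> fg a; apply: (@walk_le_in (fun _ _ => True)). Qed.

Lemma walk_const (c : R) s a : walk (fun=> c) s a = c.
Proof. by elim: s a => //= v s IH a; rewrite !IH; field. Qed.

Lemma walk_ub f (M : R) s : (forall x, f x <= M) -> forall a, walk f s a <= M.
Proof. by move=> fM a; rewrite -(walk_const M s a) walk_le. Qed.

Lemma walk_ge0 f s : (forall x, 0 <= f x) -> forall a, 0 <= walk f s a.
Proof. by move=> f0 a; rewrite -(walk_const 0 s a) walk_le. Qed.

Lemma rho_ge0 s a : 0 <= rho s a.
Proof. by apply: walk_ge0 => x; rewrite ler0n. Qed.

Lemma rho_catr_ub s t (M : R) : (forall a, rho t a <= M) ->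
  forall a, rho (s ++ t) a <= M.
Proof. by move=> H a; rewrite /rho walk_cat; apply: walk_ub. Qed.

Lemma law_ge0 s p : p \in law s -> 0 <= p.1.
Proof.
elim: s p => [|v s IH] p /=; first by rewrite inE => /eqP ->; rewrite ler01.
by rewrite !mem_cat => /or3P[] /mapP[q /IH q0 ->]; apply: mulr_ge0.
Qed.

(* For uniq [X] the left side is at most [\sum_x rho t x * P(S_t = x)]. *)
Lemma rho_energy X t : uniq X -> \sum_(x <- X) rho t x ^+ 2 <= rho (t ++ t) 0.
Proof.
move=> uX.
have -> : rho (t ++ t) 0 = \sum_(p <- law t) p.1 * rho t p.2.
  by rewrite {1}/rho walk_cat walk_law; apply: eq_bigr => p _; rewrite add0r.
have E x : rho t x = \sum_(p <- law t) p.1 * (p.2 == x)%:R.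
  rewrite -rhoN /rho walk_law; apply: eq_bigr => p _.
  by rewrite addrC subr_eq0.
under eq_bigr => x _ do rewrite expr2 {2}E mulr_sumr.
rewrite exchange_big /=; rewrite !big_seq; apply: ler_sum => p pt.
have p0 := law_ge0 pt.
under eq_bigr => x _ do rewrite mulrCA.
rewrite -mulr_sumr; apply: ler_wpM2l => //.
have [pX|pX] := boolP (p.2 \in X).
  rewrite (bigD1_seq p.2) //= eqxx mulr1 big1 ?addr0 // => x /negbTE.
  by rewrite eq_sym => ->; rewrite mulr0.
rewrite big_seq big1 ?rho_ge0 // => x xX.
by case: eqP => [px|_]; rewrite ?mulr0 //; rewrite px xX in pX.
Qed.

Lemma rho_sqr s a : rho s a ^+ 2 <= rho (s ++ s) 0.
Proof. by have := @rho_energy [:: a] s isT; rewrite big_seq1. Qed.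

(** Cauchy-Schwarz. Summed over the distinct endpoints [x] of the walk [s], the product
    [rho s x * rho t (a + x)] is at most half the sum of the two squares, and [rho_energy] bounds
    each sum of squares. *)
Lemma rho_cat_max s t a :
  rho (s ++ t) a <= Num.max (rho (s ++ s) 0) (rho (t ++ t) 0).
Proof.
have -> : rho (s ++ t) a = \sum_(x <- undup (map snd (law s))) rho s x * rho t (a + x).
  rewrite {1}/rho walk_cat walk_law.
  have E x : rho s x = \sum_(p <- law s) p.1 * (p.2 == x)%:R.
    rewrite -rhoN /rho walk_law; apply: eq_bigr => p _.
    by rewrite addrC subr_eq0.
  under [in RHS]eq_bigr => x _ do rewrite E mulr_suml.
  rewrite -!/(rho t _).
  rewrite exchange_big /= [LHS]big_seq [RHS]big_seq; apply: eq_bigr => p ps.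
  rewrite (bigD1_seq p.2) ?undup_uniq ?mem_undup ?map_f //= eqxx mulr1.
  rewrite [X in _ = _ + X]big1 ?addr0 // => x /negbTE.
  by rewrite eq_sym => ->; rewrite mulr0 mul0r.
set X := undup _; set m := Num.max _ _.
have H1 : \sum_(x <- X) rho s x ^+ 2 <= m.
  by apply: le_trans (rho_energy _ (undup_uniq _)) _; rewrite le_max lexx.
have H2 : \sum_(x <- X) rho t (a + x) ^+ 2 <= m.
  rewrite -(big_map (fun x => a + x) xpredT (fun x => rho t x ^+ 2)).
  apply: le_trans (rho_energy _ _) _; last by rewrite le_max lexx orbT.
  by rewrite map_inj_uniq ?undup_uniq //; apply: addrI.
apply: (@le_trans _ _ (\sum_(x <- X) (rho s x ^+ 2 + rho t (a + x) ^+ 2) / 2)).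
  apply: ler_sum => x _; have := sqr_ge0 (rho s x - rho t (a + x)); nra.
rewrite -mulr_suml big_split /=; lra.
Qed.

Lemma rho_double_max s a : rho (s ++ s) a <= rho (s ++ s) 0.
Proof. by have := rho_cat_max s s a; rewrite maxxx. Qed.

Definition dup s := s ++ s.

(** A doubled walk is most likely to be at its origin, so averaging over the steps of [s] can only
    lose. *)
Lemma rho_dup_catr s t : rho (dup (s ++ t)) 0 <= rho (dup t) 0.
Proof.
have -> : rho (dup (s ++ t)) 0 = rho ((s ++ s) ++ (t ++ t)) 0.
  by apply: rho_perm; rewrite /dup; apply/permP => p; rewrite !count_cat; ring.
by apply: rho_catr_ub; apply: rho_double_max.
Qed.

Definition rep k s := flatten (nseq k s).

Lemma count_rep p k s : count p (rep k s) = (k * count p s)%N.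
Proof. by rewrite /rep count_flatten map_nseq sumn_nseq mulnC. Qed.

(* Halving the block while doubling the multiplicities: [rho_cat_max] applied
   to the two halves, each with a copy of [w]. *)
Lemma rho_concentrate j k w s : size s = (2 ^ j)%N ->
  exists2 v, v \in s & rho (w ++ w ++ rep k s) 0 <= rho (w ++ w ++ nseq (k * 2 ^ j) v) 0.
Proof.
elim: j k s => [|j IH] k s sz.
  case: s sz => [//|v [|//]] _; exists v; rewrite ?mem_head // muln1.
  have -> : rep k [:: v] = nseq k v by elim: k => //= k <-.
  exact: lexx.
pose s1 := take (2 ^ j) s; pose s2 := drop (2 ^ j) s.
have sE : s = s1 ++ s2 by rewrite cat_take_drop.
have sz1 : size s1 = (2 ^ j)%N by rewrite size_take sz expnS; case: ifP => //; lia.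
have sz2 : size s2 = (2 ^ j)%N by rewrite size_drop sz expnS; lia.
have E : rho (w ++ w ++ rep k s) 0 = rho ((w ++ rep k s1) ++ (w ++ rep k s2)) 0.
  apply: rho_perm; apply/permP => p; rewrite !count_cat !count_rep sE count_cat.
  by lia.
have D s' : rho ((w ++ rep k s') ++ (w ++ rep k s')) 0 =
            rho (w ++ w ++ rep (k * 2) s') 0.
  by apply: rho_perm; apply/permP => p; rewrite !count_cat !count_rep; lia.
have := rho_cat_max (w ++ rep k s1) (w ++ rep k s2) 0.
rewrite -E !D le_max => /orP[] H.
  have [v vs1 L] := IH (k * 2)%N s1 sz1; exists v; first by rewrite sE mem_cat vs1.
  by rewrite expnS mulnA; apply: le_trans L.
have [v vs2 L] := IH (k * 2)%N s2 sz2; exists v; first by rewrite sE mem_cat vs2 orbT.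
by rewrite expnS mulnA; apply: le_trans L.
Qed.

Lemma rho_dup_concentrate j w s : size s = (2 ^ j)%N ->
  exists2 v, v \in s & rho (dup (w ++ s)) 0 <= rho (dup (w ++ nseq (2 ^ j) v)) 0.
Proof.
move=> sz; have [v vs L] := rho_concentrate 2 w sz; exists v => //.
have <- : rho (w ++ w ++ rep 2 s) 0 = rho (dup (w ++ s)) 0.
  by apply: rho_perm; apply/permP => p; rewrite /dup /rep /= !count_cat /=; lia.
apply: (le_trans L); rewrite le_eqVlt; apply/orP; left; apply/eqP.
by apply: rho_perm; apply/permP => p; rewrite /dup !count_cat !count_nseq; lia.
Qed.

Lemma walk_supp_nseq f m v a : walk f (nseq m v) a != 0 ->
  exists2 i : int, (`|i| <= m)%N & f (a + v *~ i) != 0.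
Proof.
elim: m a => [|m IH] a /=; first by exists 0 => //; rewrite mulr0z addr0.
have [E|/IH[i im fi] _] := eqVneq (walk f (nseq m v) a) 0; last first.
  by exists i => //; lia.
rewrite E mulr0 add0r.
have [E1|/IH[i im fi] _] := eqVneq (walk f (nseq m v) (a + v)) 0; last first.
  exists (1 + i); first lia.
  by rewrite mulrzDr mulr1z addrA.
have [E2|/IH[i im fi] _] := eqVneq (walk f (nseq m v) (a - v)) 0; last first.
  exists (- 1 + i); first lia.
  by rewrite mulrzDr mulrNz mulr1z addrA.
by rewrite E1 E2 addr0 mulr0 eqxx.
Qed.

End OneGroup.

(** Only compatibility with the steps of [s] is asked of [phi], so affine maps such as
    [i |-> x + v *~ i] are covered as well as homomorphisms. *)
Lemma walk_map (V W : zmodType) (phi : V -> W) (f : W -> R) s a b :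
    (forall x v, v \in s -> phi (x + v) = phi x + b v) ->
    (forall x v, v \in s -> phi (x - v) = phi x - b v) ->
  walk f (map b s) (phi a) = walk (f \o phi) s a.
Proof.
elim: s a => [//|v s IH] a pD pB /=.
rewrite -pD ?mem_head // -pB ?mem_head //.
by rewrite !IH // => x w ws; (apply: pD || apply: pB); rewrite inE ws orbT.
Qed.

End Walk.

(** * The lazy walk on the integers *)

Lemma leq_bin_half n i : ('C(n, i) <= 'C(n, n./2))%N.
Proof.
have up k j : (j + k = n./2 -> 'C(n, j) <= 'C(n, n./2))%N.
  elim: k j => [|k IH] j E; first by rewrite -E addn0.
  apply: leq_trans (IH j.+1 _); last by rewrite addSnnS.
  rewrite -(leq_pmul2r (ltn0Sn j)) [leqRHS]mulnC mul_bin_left mulnC leq_mul2r.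
  by apply/orP; right; have := odd_double_half n; lia.
have [ni|ni] := leqP i n./2; first by apply: (up (n./2 - i)%N); lia.
have [ni'|ni'] := leqP i n; last by rewrite bin_small.
by rewrite -bin_sub //; apply: (up (n./2 - (n - i))%N);
  have := odd_double_half n; lia.
Qed.

(** Induction through the ratio of consecutive central binomials, equation [E], together with
    [(2j+1)(2j+3) <= 4(j+1)^2]. *)
Lemma central_bin_bound j : ('C(j.*2, j) ^ 2 * j.*2.+1 <= 16 ^ j)%N.
Proof.
elim: j => [//|j IH].
have E : (j.+1 * 'C(j.+1.*2, j.+1) = 2 * j.*2.+1 * 'C(j.*2, j))%N.
  have e1 := mul_bin_diag j.*2.+2 j; have e2 := mul_bin_down j.*2.+1 j.
  rewrite -doubleS /= in e1; have e3 : (j.*2.+1 - j = j.+1)%N by lia.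
  rewrite e3 /= in e2; rewrite -e1.
  apply/eqP; rewrite -(eqn_pmul2l (ltn0Sn j)); apply/eqP.
  by rewrite mulnCA -e2 doubleS; lia.
have K : (j.*2.+1 * j.+1.*2.+1 <= 4 * j.+1 ^ 2)%N by nia.
have K2 : ((j.+1 * 'C(j.+1.*2, j.+1)) ^ 2 * j.+1.*2.+1 <= j.+1 ^ 2 * 16 ^ j.+1)%N.
  rewrite E; set c := 'C(_, _) in IH *.
  apply: (@leq_trans (4 * (c ^ 2 * j.*2.+1) * (j.*2.+1 * j.+1.*2.+1))%N).
    apply: eq_leq; move: (j.*2.+1)%N (j.+1.*2.+1)%N => u v.
    by rewrite expnMn; nia.
  apply: (@leq_trans (4 * 16 ^ j * (4 * j.+1 ^ 2))%N).
    by rewrite leq_mul // leq_mul.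
  rewrite (expnS 16); apply: eq_leq; move: (16 ^ j)%N (j.+1 ^ 2)%N => u v; nia.
by rewrite expnMn -mulnA leq_pmul2l // in K2; rewrite expn_gt0.
Qed.

Lemma bin_sqr_bound k i : ('C(k, i) ^ 2 * k.+1 <= 4 ^ k)%N.
Proof.
apply: (@leq_trans ('C(k, k./2) ^ 2 * k.+1)%N).
  by rewrite leq_mul2r leq_exp2r // leq_bin_half orbT.
rewrite -(odd_double_half k); set j := k./2.
case: (odd k); rewrite ?add0n ?add1n /=; last first.
  rewrite doubleK -[X in (_ <= 4 ^ X)%N]mul2n expnM; exact: central_bin_bound.
rewrite uphalf_double.
(* In an odd row the middle entry is half of the next central binomial. *)
have E : ('C(j.+1.*2, j.+1) = 2 * 'C(j.*2.+1, j))%N.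
  rewrite doubleS binS mulSn mul1n; congr (_ + _)%N.
  by rewrite -bin_sub; [congr 'C(_, _); lia | lia].
have -> : (4 ^ (j.*2.+1) = 4 * 16 ^ j)%N by rewrite expnS -mul2n expnM.
have := central_bin_bound j.+1; rewrite E (expnS 16) expnMn.
move: ('C(_, _) ^ 2)%N (16 ^ j)%N => c p.
by rewrite doubleS -mulnA (mulnS c); move: (c * _)%N => d; lia.
Qed.

Section IntWalk.
Variable R : realFieldType.

Lemma rho_simple_lt0 k (a : int) : a + k%:Z < 0 -> rho (1 : R) (nseq k 1) a = 0.
Proof.
elim: k a => [|k IH] a ak; rewrite /rho /=.
  by case: eqP => // E; move: ak; rewrite E addr0 ltxx.
rewrite -!/(rho _ _ _) (IH a) ?(IH (a + 1)) ?(IH (a - 1)) ?addr0 ?mulr0 ?addr0 //; lia.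
Qed.

(** For [mu = 1] every step moves. From [N - k] the origin is reached after [k] steps exactly when
    [N / 2] of them go down; the induction is Pascal's rule. *)
Lemma rho_simple k N :
  rho (1 : R) (nseq k 1) (N%:Z - k%:Z) = (if odd N then 0 else 'C(k, N./2)%:R) / 2 ^+ k.
Proof.
elim: k N => [|k IH] N.
  rewrite /rho /= subr0 expr0 divr1; case: N => [|[|N]] //=.
  by case: (odd N).
rewrite [LHS]/= /rho /= -!/(rho _ _ _) subrr mul0r add0r.
have -> : N%:Z - k.+1%:Z + 1 = N%:Z - k%:Z by lia.
rewrite -/(rho _ _ _) IH.
case: N => [|[|N]].
- rewrite [X in _ + X](rho_simple_lt0) ?addr0 /=; last by lia.
  by rewrite !bin0 exprS; field; rewrite expf_neq0 // pnatr_eq0.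
- rewrite [X in _ + X](rho_simple_lt0) ?addr0 /=; last by lia.
  by rewrite !mul0r mulr0.
have -> : N.+2%:Z - k.+1%:Z - 1 = N%:Z - k%:Z by lia.
rewrite IH /= negbK; case: (odd N); first by rewrite !mul0r addr0 mulr0.
by rewrite binS natrD exprS; field; rewrite expf_neq0 // pnatr_eq0.
Qed.

Lemma rho_simple_bound k (a : int) : rho (1 : R) (nseq k 1) a ^+ 2 * k.+1%:R <= 1.
Proof.
have [H|H] := ltP (a + k%:Z) 0.
  by rewrite rho_simple_lt0 // expr0n mul0r ler01.
have -> : a = Posz (absz (a + k%:Z)) - k%:Z by lia.
rewrite rho_simple; case: (odd _); first by rewrite mul0r expr0n mul0r ler01.
rewrite expr_div_n mulrAC ler_pdivrMr ?exprn_gt0 ?ltr0n // mul1r.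
rewrite -exprM mulnC exprM -natrX -natrM -!natrX ler_nat.
exact: bin_sqr_bound.
Qed.

Variable mu : R.
Hypotheses (mu_ge0 : 0 <= mu) (mu_le1 : mu <= 1).

Lemma walk_avg (f : int -> R) s a :
  walk mu (fun x => (f (x + 1) + f (x - 1)) / 2) s a =
  (walk mu f s (a + 1) + walk mu f s (a - 1)) / 2.
Proof.
elim: s a => [//|v s IH] a /=; rewrite !IH.
by rewrite !(addrAC _ v) !(addrAC _ (- v)); ring.
Qed.

(* [(k + 1 + mu m / 2)^(-1/2)] is a supersolution of the recursion in [m] and
   [k] obtained by deciding for each lazy step whether it moves. *)
Lemma walk_lazy_bound m k (a : int) :
  walk mu (rho (1 : R) (nseq k 1)) (nseq m 1) a ^+ 2 * (k.+1%:R + mu * m%:R / 2) <= 1.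
Proof.
elim: m k a => [|m IH] k a.
  by rewrite mulr0 mul0r addr0; apply: rho_simple_bound.
have E : walk mu (rho 1 (nseq k 1)) (nseq m.+1 1) a =
    (1 - mu) * walk mu (rho 1 (nseq k 1)) (nseq m 1) a +
    mu * walk mu (rho 1 (nseq k.+1 1)) (nseq m 1) a.
  have -> : walk mu (rho 1 (nseq k.+1 1)) (nseq m 1) a =
      walk mu (fun x => (rho (1 : R) (nseq k 1) (x + 1) + rho (1 : R) (nseq k 1) (x - 1)) / 2)
        (nseq m 1) a.
    by apply: eq_walk => x; rewrite {1}/rho /= -!/(rho _ _ _); ring.
  by rewrite walk_avg /=; ring.
have := IH k a; have := IH k.+1 a; rewrite E.
set x := walk _ (rho 1 (nseq k 1)) _ _; set y := walk _ _ _ _.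
have -> : k.+2%:R = k.+1%:R + 1 :> R by rewrite natr1.
have -> : m.+1%:R = m%:R + 1 :> R by rewrite natr1.
set t := k.+1%:R + mu * (m%:R + 1) / 2; pose h := mu / 2.
have t1 : 1 <= t - h.
  have : 0 <= mu * m%:R by rewrite mulr_ge0.
  have : 1 <= k.+1%:R :> R by rewrite ler1n.
  by rewrite /t /h; lra.
have -> : k.+1%:R + 1 + mu * m%:R / 2 = t - h + 1 by rewrite /t /h; ring.
have -> : k.+1%:R + mu * m%:R / 2 = t - h by rewrite /t /h; ring.
move=> Hy Hx.
have h0 : 0 <= h by rewrite /h divr_ge0 ?ler0n.
have Hy' : y ^+ 2 <= (t - h + 1)^-1.
  by rewrite -div1r ler_pdivlMr //; lra.
have Hx' : x ^+ 2 <= (t - h)^-1.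
  by rewrite -div1r ler_pdivlMr //; lra.
(* Convexity of the square, so that the two induction hypotheses can be averaged. *)
have C1 : ((1 - mu) * x + mu * y) ^+ 2 <= (1 - mu) * x ^+ 2 + mu * y ^+ 2.
  rewrite -subr_ge0.
  have -> : (1 - mu) * x ^+ 2 + mu * y ^+ 2 - ((1 - mu) * x + mu * y) ^+ 2 =
    mu * (1 - mu) * (x - y) ^+ 2 by ring.
  by apply: mulr_ge0 (sqr_ge0 _); apply: mulr_ge0; rewrite ?subr_ge0.
have C2 : (1 - mu) * x ^+ 2 + mu * y ^+ 2 <= (1 - mu) / (t - h) + mu / (t - h + 1).
  by rewrite lerD // ler_wpM2l ?subr_ge0.
rewrite -ler_pdivlMr; last by lra.
apply: le_trans C1 _; apply: le_trans C2 _; rewrite -subr_ge0.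
have -> : 1 / t - ((1 - mu) / (t - h) + mu / (t - h + 1)) =
   (h * (t - 1) + h ^+ 2) / (t * (t - h) * (t - h + 1)).
  have -> : mu = 2 * h by rewrite /h; field.
  by field; apply/and3P; split; apply: lt0r_neq0; lra.
apply: divr_ge0.
  by apply: addr_ge0 (sqr_ge0 _); apply: mulr_ge0 => //; lra.
by apply: mulr_ge0; [apply: mulr_ge0|]; lra.
Qed.

Lemma rho_int_bound m (a : int) : rho mu (nseq m 1) a ^+ 2 * (1 + mu * m%:R / 2) <= 1.
Proof. exact: (walk_lazy_bound m 0 a). Qed.

End IntWalk.

(** * Walks with repeated steps *)

Section Peel.
Variables (R : realFieldType) (mu : R).
Hypotheses (mu_ge0 : 0 <= mu) (mu_le1 : mu <= 1).

Lemma walk_le_value (V : zmodType) (f : V -> R) s a : exists y, walk mu f s a <= f y.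
Proof.
elim: s a => [|v s IH] a /=; first by exists a.
have [y1 H1] := IH a; have [y2 H2] := IH (a + v); have [y3 H3] := IH (a - v).
have [y [L1 L2 L3]] : exists y, [/\ f y1 <= f y, f y2 <= f y & f y3 <= f y].
  case: (lerP (f y1) (f y2)) => h12; case: (lerP (f y1) (f y3)) => h13;
  case: (lerP (f y2) (f y3)) => h23; first
    [ by exists y1; split; lra | by exists y2; split; lra | by exists y3; split; lra ].
exists y; have -> : f y = (1 - mu) * f y + mu / 2 * (f y + f y) by field.
have mu1 : 0 <= 1 - mu by rewrite subr_ge0.
have mu2 : 0 <= mu / 2 by rewrite divr_ge0 ?ler0n.
by apply: lerD; apply: ler_wpM2l => //; [|apply: lerD]; lra.
Qed.

Lemma walk_scale_shift (V : zmodType) (f : V -> R) (M : R) b s a :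
  walk mu (fun x => M * f (x + b)) s a = M * walk mu f s (a + b).
Proof.
by elim: s a => //= v s IH a; rewrite !IH (addrAC a v b) (addrAC a (- v) b); ring.
Qed.

(** All but the last [m'] steps are averaged away. The last [m'] steps move along multiples of [v],
    at most one of which meets the support of [f], so what remains is a value of [f] times a hitting
    probability of the integer walk. *)
Lemma walk_peel (V : zmodType) (f : V -> R) (M c : R) E (m' m : nat) v a :
    (m' <= m)%N -> (0 < E)%N -> (forall x, 0 <= f x) -> (forall x, f x ^+ E <= M) ->
    (forall i, rho mu (nseq m' 1) (i : int) ^+ E <= c) ->
    (forall x (i j : int), (`|i| <= m')%N -> (`|j| <= m')%N ->
      f (x + v *~ i) != 0 -> f (x + v *~ j) != 0 -> i = j) ->
  walk mu f (nseq m v) a ^+ E <= M * c.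
Proof.
move=> mm E0 f0 fM rc uni.
have M0 : 0 <= M by apply: le_trans (fM 0); rewrite exprn_ge0.
have c0 : 0 <= c by apply: le_trans (rc 0); rewrite exprn_ge0 // rho_ge0.
have -> : nseq m v = nseq (m - m') v ++ nseq m' v by rewrite -nseqD subnK.
rewrite walk_cat; have [x Hx] := walk_le_value (walk mu f (nseq m' v)) (nseq (m - m') v) a.
apply: (@le_trans _ _ (walk mu f (nseq m' v) x ^+ E)).
  by rewrite lerXn2r ?nnegrE ?walk_ge0 // => y; rewrite walk_ge0.
have -> : walk mu f (nseq m' v) x = walk mu (fun i => f (x + v *~ i)) (nseq m' 1) 0.
  have -> : nseq m' v = map (fun=> v) (nseq m' (1 : int)) by rewrite map_nseq.
  rewrite -[x in LHS]addr0 -(mulr0z v).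
  apply: (@walk_map _ _ _ _ (fun i => x + v *~ i)) => y w; rewrite mem_nseq => /andP[_ /eqP ->].
    by rewrite mulrzDr mulr1z addrA.
  by rewrite mulrzBr mulr1z addrA.
have [[i0 [i0m fi0]]|none] := pselect (exists i : int, (`|i| <= m')%N /\ f (x + v *~ i) != 0).
  apply: (@le_trans _ _ ((f (x + v *~ i0) * rho mu (nseq m' 1) (0 - i0)) ^+ E)).
    rewrite lerXn2r ?nnegrE ?mulr_ge0 ?rho_ge0 ?walk_ge0 //.
    rewrite -walk_scale_shift.
    apply: (@walk_le_in _ _ _ mu_ge0 mu_le1 (fun k i => (`|i| <= k)%N)) => //.
      by move=> k i w ki; rewrite mem_nseq => /andP[_ /eqP ->]; split; lia.
    move=> i; rewrite size_nseq => im; have [->|fi] := eqVneq (f (x + v *~ i)) 0.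
      by rewrite mulr_ge0.
    by rewrite (uni _ _ _ im i0m fi fi0) subrr eqxx mulr1.
  by rewrite exprMn ler_pM ?exprn_ge0 ?rho_ge0.
apply: (@le_trans _ _ (0 ^+ E)); last by rewrite expr0n eqn0Ngt E0 mulr_ge0.
rewrite lerXn2r ?nnegrE ?walk_ge0 //.
rewrite -(walk_const mu (0 : R) (nseq m' 1) (0 : int)).
apply: (@walk_le_in _ _ _ mu_ge0 mu_le1 (fun k i => (`|i| <= k)%N)) => //.
  by move=> k i w ki; rewrite mem_nseq => /andP[_ /eqP ->]; split; lia.
move=> i; rewrite size_nseq => im; have [->//|fi] := eqVneq (f (x + v *~ i)) 0.
by case: none; exists i.
Qed.

Definition blocks (V : zmodType) m (us : seq V) := flatten [seq nseq m u | u <- us].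

Lemma rho_blocks_cons (V : zmodType) m (u : V) us a :
  rho mu (blocks m (u :: us)) a = walk mu (rho mu (blocks m us)) (nseq m u) a.
Proof. by rewrite /rho /blocks /= walk_cat. Qed.

(** Coefficients are indexed by all naturals, so that putting a vector in front of [w] is a shift;
    those past [size w] do not enter. *)
Definition comb (V : zmodType) (w : seq V) (c : nat -> int) : V :=
  \sum_(h < size w) w`_h *~ c h.

Lemma comb_cons (V : zmodType) (v : V) w c :
  comb (v :: w) c = v *~ c 0%N + comb w (fun h => c h.+1).
Proof. by rewrite /comb /= big_ord_recl. Qed.

Lemma combB (V : zmodType) (w : seq V) c e :
  comb w (fun h => c h - e h) = comb w c - comb w e.
Proof. by rewrite /comb -sumrB; apply: eq_bigr => h _; rewrite mulrzBr. Qed.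

Definition dissociated (V : zmodType) (N : nat) (w : seq V) :=
  forall c : nat -> int, (forall h, (h < size w)%N -> (`|c h| <= N)%N) ->
    comb w c = 0 -> forall h, (h < size w)%N -> c h = 0.

Lemma rho_blocks_supp (V : zmodType) m (us : seq V) a : rho mu (blocks m us) a != 0 ->
  exists c : nat -> int, (forall h, (`|c h| <= m)%N) /\ a = comb us c.
Proof.
elim: us a => [|u us IH] a.
  rewrite /rho /=; have [-> _|_] := eqVneq a 0; last by rewrite eqxx.
  by exists (fun=> 0); split => //; rewrite /comb big_ord0.
rewrite rho_blocks_cons => H; have [i im] := walk_supp_nseq mu_ge0 mu_le1 H.
move=> /IH[c [cm ac]].
exists (fun h => if h is h'.+1 then c h' else - i); split; first by case=> //; rewrite abszN.
by rewrite comb_cons /= -ac mulrNz addrC addrK.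
Qed.

(* The bound on [2m] relations makes the boxes of side [m] injective. *)
Lemma rho_blocks_dissociated (V : zmodType) m (us : seq V) (E : nat) (c : R) : (0 < E)%N ->
    (forall i, rho mu (nseq m 1) (i : int) ^+ E <= c) ->
    dissociated (2 * m) us ->
  forall a, rho mu (blocks m us) a ^+ E <= c ^+ size us.
Proof.
move=> E0 rc; elim: us => [|u us IH] dis a.
  by rewrite /= expr0 exprn_ile1 ?rho_ge0 // walk_ub // => x; case: eqP.
rewrite rho_blocks_cons exprSr; apply: (walk_peel (m' := m)) => //.
- by move=> x; rewrite rho_ge0.
- apply: IH => e eb e0 h hs.
  apply: (dis (fun k => if k is k'.+1 then e k' else 0) _ _ h.+1 hs) => [[//|k] ks|].
    exact: eb.
  by rewrite comb_cons /= mulr0z add0r.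
move=> x i j im jm Hi Hj.
have [e [em xe]] := rho_blocks_supp Hi; have [g [gm xg]] := rho_blocks_supp Hj.
pose z k := if k is k'.+1 then e k' - g k' else j - i.
suff /eqP : z 0%N = 0 by rewrite subr_eq0 => /eqP.
apply: dis => //.
  by rewrite /z => -[_|k ks] /=; [lia | have := em k; have := gm k; lia].
rewrite comb_cons combB -xe -xg mulrzBr; move: (u *~ i) (u *~ j) => p q.
have -> : x + p - (x + q) = p - q by rewrite opprD addrACA subrr add0r.
by rewrite addrA subrK subrr.
Qed.

(** The exponent 4, larger than the natural 2, absorbs [mu]: only the threshold for [m] depends on
    [mu]. This keeps the number of stages in [phase1] independent of [mu]. *)
Lemma rho_int_bound4 m (i : int) : 4 <= mu ^+ 2 * m%:R -> 
  rho mu (nseq m 1) i ^+ 4 <= m%:R^-1.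
Proof.
move=> H; have m0 : 0 < m%:R :> R.
  by rewrite lt0r ler0n andbT; apply/eqP => E; move: H; rewrite E mulr0; lra.
have := rho_int_bound mu_ge0 mu_le1 m i; set r := rho _ _ _; set t := 1 + _.
have tm : m%:R <= t ^+ 2.
  have : 0 <= mu * m%:R by rewrite mulr_ge0 // ltW.
  have -> : t ^+ 2 = 1 + mu * m%:R + m%:R * (mu ^+ 2 * m%:R) / 4 by rewrite /t; field.
  by nra.
move=> rt; rewrite -div1r ler_pdivlMr //.
apply: (@le_trans _ _ (r ^+ 4 * t ^+ 2)); first by rewrite ler_wpM2l // exprn_even_ge0.
rewrite (exprM r 2 2) -exprMn exprn_ile1 // mulr_ge0 ?sqr_ge0 //.
by rewrite /t addr_ge0 // divr_ge0 // mulr_ge0 // ltW.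
Qed.

(** By Bernoulli's inequality. In contrast to [rho_int_bound4] it is valid for every [m], at the
    price of an exponent depending on [mu]. *)
Lemma rho_int_bound_pow (E0 m : nat) (i : int) : 2 <= mu * E0%:R ->
  rho mu (nseq m 1) i ^+ (2 * E0) <= m.+1%:R^-1.
Proof.
move=> H.
have := rho_int_bound mu_ge0 mu_le1 m i; set r := rho _ _ _; set t := 1 + _.
have x0 : 0 <= mu * m%:R / 2 by rewrite divr_ge0 // mulr_ge0.
have tm : m.+1%:R <= t ^+ E0.
  have B : forall k, 1 + k%:R * (mu * m%:R / 2) <= t ^+ k.
    elim=> [|k IH]; first by rewrite expr0 mul0r addr0.
    rewrite exprS /t; rewrite /t in IH; apply: (@le_trans _ _ ((1 + mu * m%:R / 2) * (1 + k%:R * (mu * m%:R / 2)))).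
      rewrite -natr1; have : 0 <= k%:R * (mu * m%:R / 2) by rewrite mulr_ge0.
      by nra.
    by rewrite ler_wpM2l // addr_ge0.
  apply: le_trans (B E0); rewrite -natr1.
  have : 0 <= m%:R :> R by []. nra.
move=> rt; rewrite -div1r ler_pdivlMr ?ltr0n //.
have t0 : 0 <= t by rewrite /t addr_ge0.
apply: (@le_trans _ _ (r ^+ (2 * E0) * t ^+ E0)).
  by rewrite ler_wpM2l // exprn_ge0 // rho_ge0.
by rewrite exprM -exprMn exprn_ile1 // mulr_ge0 ?sqr_ge0.
Qed.

(** [p.-1./2] is the largest [m'] with [2 * m' < p], the range in which multiples of an element of
    order [p] stay distinct, and its successor squared is at least [p]. If it exceeds [m], the
    hypothesis [p <= m ^ L] takes over. *)
Lemma rho_int_gain (E0 L m p : nat) : 2 <= mu * E0%:R -> (2 <= L)%N -> (3 <= p <= m ^ L)%N ->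
  exists2 m' : nat, (m' <= m)%N && (2 * m' < p)%N &
    forall i : int, rho mu (nseq m' 1) i ^+ (2 * E0 * L) <= p%:R^-1.
Proof.
move=> H L2 /andP[p3 pm]; exists (minn m p.-1./2).
  by rewrite geq_minl /=; have := odd_double_half p.-1; lia.
set m' := minn _ _ => j.
rewrite exprM; apply: (@le_trans _ _ (m'.+1%:R^-1 ^+ L)).
  by apply: lerXn2r; rewrite ?nnegrE ?invr_ge0 ?ler0n ?rho_int_bound_pow //;
    apply: exprn_ge0; apply: rho_ge0.
rewrite exprVn lef_pV2 ?posrE ?exprn_gt0 ?ltr0n //; last lia.
rewrite -natrX ler_nat /m'; have [mp|mp] := leqP m p.-1./2.
  by apply: leq_trans pm _; rewrite leq_exp2r; lia.
have E : (p <= p.-1./2.+1 ^ 2)%N by have := odd_double_half p.-1; nia.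
by apply: leq_trans E _; apply: leq_pexp2l.
Qed.

Lemma remaining_step (I : finType) (V : zmodType) (b : I -> V) j (rem B : {set I}) (tl : seq V) :
    B \subset rem -> (2 ^ j <= #|B|)%N ->
  exists2 u, u \in B & exists rem' : {set I},
    [/\ rem' \subset rem, #|~: rem'| = (#|~: rem| + 2 ^ j)%N &
     rho mu (dup (map b (enum rem) ++ tl)) 0 <=
     rho mu (dup (map b (enum rem') ++ nseq (2 ^ j) (b u) ++ tl)) 0].
Proof.
move=> Brem cB; pose l := take (2 ^ j) (enum B).
have sl : size l = (2 ^ j)%N by rewrite size_takel // -cardE.
have lB x : x \in l -> x \in B by move=> /mem_take; rewrite mem_enum.
have ul : uniq l by rewrite take_uniq ?enum_uniq.
have subl : [set x in l] \subset rem.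
  by apply/fintype.subsetP => x; rewrite inE => /lB /(fintype.subsetP Brem).
pose rem' := rem :\: [set x in l].
have P : perm_eq (map b (enum rem) ++ tl) ((map b (enum rem') ++ tl) ++ map b l).
  rewrite perm_sym perm_catAC perm_cat2r -map_cat; apply: perm_map.
  apply: uniq_perm; rewrite ?enum_uniq //.
    rewrite cat_uniq enum_uniq ul andbT /=; apply/hasPn => x xl.
    by rewrite mem_enum !inE xl.
  move=> x; rewrite mem_cat !mem_enum !inE; case xl: (x \in l) => //=.
    by rewrite (fintype.subsetP Brem) ?lB.
  by rewrite orbF.
have [v /mapP[u ul' ->] H] := rho_dup_concentrate mu_ge0 mu_le1 (map b (enum rem') ++ tl)
  (etrans (size_map b l) sl).
exists u; first exact: lB.
exists rem'; split; first exact: finset.subsetDl.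
  have := cardsC rem; have := cardsC rem'; rewrite [in X in X -> _]cardsD.
  by rewrite (finset.setIidPr subl) cardsE (card_uniqP ul) sl;
    have := subset_leq_card subl; rewrite cardsE (card_uniqP ul) sl; lia.
rewrite (_ : rho mu (dup (map b (enum rem) ++ tl)) 0 =
  rho mu (dup ((map b (enum rem') ++ tl) ++ map b l)) 0); last first.
  by apply: rho_perm; apply: perm_cat.
apply: (le_trans H); rewrite le_eqVlt; apply/orP; left; apply/eqP; apply: rho_perm.
by apply: perm_cat; rewrite -catA perm_cat2l perm_catC.
Qed.

End Peel.

(** * Greedy choice of independent steps *)

Section Greedy.
Variables (R : realFieldType) (mu : R).
Hypotheses (mu_ge0 : 0 <= mu) (mu_le1 : mu <= 1).

Definition related (V : zmodType) (N : nat) (w : seq V) (v : V) :=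
  exists (k : int) (c : nat -> int), [/\ k != 0, (`|k| <= N)%N,
    forall h, (h < size w)%N -> (`|c h| <= N)%N & v *~ k = comb w c].

Lemma dissociated_cons (V : zmodType) N N' (w : seq V) v : (N' <= N)%N ->
  dissociated N w -> ~ related N' w v -> dissociated N' (v :: w).
Proof.
move=> NN dw nr c cN; rewrite comb_cons => c0.
have c00 : c 0%N = 0.
  apply/eqP/negPn/negP => c00; apply: nr; exists (- c 0%N), (fun h => c h.+1); split.
  - by rewrite oppr_eq0.
  - by rewrite abszN cN.
  - by move=> h hs; apply: cN.
  by rewrite mulrNz; apply/eqP; rewrite eq_sym -addr_eq0 addrC c0.
case=> [//|h] hs; apply: (dw (fun h => c h.+1)) => //.
  by move=> k ks; apply: leq_trans NN; apply: cN.
by move: c0; rewrite c00 mulr0z add0r.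
Qed.

(** One copy of [t] is kept and all other steps are averaged away. *)
Lemma rho_dup_le_value (V : zmodType) (s t : seq V) :
  exists y, rho mu (dup (s ++ t)) 0 <= rho mu t y.
Proof.
have [y H] := walk_le_value mu_ge0 mu_le1 (rho mu t) (dup s ++ t) 0; exists y.
rewrite (_ : rho mu (dup (s ++ t)) 0 = walk mu (rho mu t) (dup s ++ t) 0) //.
rewrite -[in RHS]walk_cat; apply: rho_perm; rewrite /dup; apply/permP => p.
by rewrite !count_cat; lia.
Qed.

Section Phases.
Variables (I : finType) (b : I -> R) (s c1 : nat).
Let m := (2 ^ s)%N.
Let m_gt0 : (0 < m)%N. Proof. by rewrite expn_gt0. Qed.

(** The doubled walk returns with probability at least [m ^ (- 2 c1)]. Here [rem] holds the
    untouched indices and [us] those on which a block of [m] steps has been concentrated; the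
    exponent is doubled because doubling a walk squares the bound. *)
Definition concentrated (rem : {set I}) (us : seq I) :=
  1 <= m%:R ^+ (2 * c1) * rho mu (dup (map b (enum rem) ++ blocks m (map b us))) 0.

Lemma concentrated_step rem us (B : {set I}) : concentrated rem us ->
    B \subset rem -> (m <= #|B|)%N ->
  exists2 u, u \in B & exists rem' : {set I},
    [/\ rem' \subset rem, #|~: rem'| = (#|~: rem| + m)%N & concentrated rem' (u :: us)].
Proof.
move=> conc Br mB.
have [u uB [rem' [r1 r2 r3]]] :=
  remaining_step mu_ge0 mu_le1 b (blocks m (map b us)) Br mB.
exists u => //; exists rem'; split => //.
by apply: (le_trans conc); rewrite ler_wpM2l // exprn_ge0 // ler0n.
Qed.

(** After [8 * c1 + 1] stages the fourth power of the return probability would be at most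
    [m ^ (- (8 c1 + 1))] by dissociation and at least [m ^ (- 8 c1)] by concentration. The process
    therefore stops earlier, with fewer than [m] unrelated indices. *)
Lemma phase1 (lev : nat -> nat) : (1 < m)%N -> 4 <= mu ^+ 2 * m%:R ->
    (forall d, lev d.+1 <= lev d)%N -> (2 * m <= lev (8 * c1).+1)%N ->
    concentrated finset.setT [::] ->
  exists (us : seq I) (rem : {set I}),
    [/\ (size us <= 8 * c1)%N, dissociated (lev (size us)) (map b us),
        (#|~: rem| <= size us * m)%N, concentrated rem [::] &
        (#|[set j in rem | ~~ `[< related (lev (size us).+1) (map b us) (b j) >] ]| < m)%N].
Proof.
move=> m1 mu4 levS lev2 conc; match goal with |- ?g => pose concl := g end.
suff H d : (d <= (8 * c1).+1)%N -> concl \/ exists (us : seq I) (rem : {set I}),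
   [/\ size us = d, dissociated (lev (size us)) (map b us), (#|~: rem| = d * m)%N &
     concentrated rem us].
  have [//|[us [rem [sz dis _ co]]]] := H _ (leqnn _); exfalso.
  have [y Hy] := rho_dup_le_value (map b (enum rem)) (blocks m (map b us)).
  have dis' : dissociated (2 * m) (map b us).
    by move=> c cN; apply: dis => h hs; apply: leq_trans (cN h hs) _; rewrite sz.
  have /(_ y) := rho_blocks_dissociated mu_ge0 mu_le1 (E := 4) isT
    (fun i => rho_int_bound4 mu_ge0 mu_le1 i mu4) dis'.
  rewrite size_map sz; move: Hy co; rewrite /concentrated.
  set r := rho _ _ y; set r0 := rho _ _ _ => r0r co r4.
  have M0 : 0 < m%:R :> R by rewrite ltr0n.
  have r1 : 1 <= m%:R ^+ (2 * c1) * r.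
    by apply: le_trans co _; rewrite ler_wpM2l // exprn_ge0 // ltW.
  have : 1 <= (m%:R ^+ (2 * c1) * r) ^+ 4 by rewrite exprn_ege1.
  rewrite exprMn -exprM => h1.
  have : 1 <= m%:R ^+ (2 * c1 * 4) * m%:R^-1 ^+ (8 * c1).+1 :> R.
    by apply: le_trans h1 _; rewrite ler_wpM2l // exprn_ge0 // ltW.
  rewrite exprVn (_ : (8 * c1).+1 = (2 * c1 * 4).+1); last by clear; lia.
  rewrite exprS invfM mulrCA divff ?mulr1; last by rewrite expf_neq0 // gt_eqF.
  by rewrite invf_ge1 // lern1 leqNgt m1.
elim: d => [_|d IH d8].
  right; exists [::], finset.setT; split => //; by rewrite finset.setCT cards0 mul0n.
have [cl|[us [rem [sz dis cr co]]]] := IH (ltnW d8).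
  by left; exact: cl.
set B := [set j in rem | ~~ `[< related (lev (size us).+1) (map b us) (b j) >] ].
have Br : B \subset rem by apply/fintype.subsetP => x; rewrite inE => /andP[].
have [mB|mB] := ltnP #|B| m.
  left; exists us, rem; split => //; rewrite ?sz ?cr //.
  (* The blocks chosen so far are dropped again, since the second phase starts from the remaining
     indices alone. *)
  apply: le_trans co _; rewrite ler_wpM2l ?exprn_ge0 ?ler0n //.
  rewrite (_ : rho mu (dup (map b (enum rem) ++ blocks m (map b us))) 0 =
               rho mu (dup (blocks m (map b us) ++ map b (enum rem))) 0); last first.
    by apply: rho_perm; rewrite /dup; apply: perm_cat; rewrite perm_catC.
  by rewrite /= cats0; apply: rho_dup_catr.
have [u uB [rem' [r1 r2 r3]]] := concentrated_step co Br mB.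
right; exists (u :: us), rem'; split; rewrite /= ?sz //; last by rewrite r2 cr mulSn addnC.
move: uB; rewrite !inE => /andP[_ /asboolPn nr].
by rewrite -sz; apply: dissociated_cons dis nr.
Qed.

(** * A common denominator for the rational coordinates *)

Section Phase2.
Variables (w : seq R) (u : I -> 'rV[rat]_(size w)) (N1 Nb : nat) (G rem0 : {set I}).

Definition realize (x : 'rV[rat]_(size w)) : R := \sum_(h < size w) ratr (x 0 h) * w`_h.

(** For [q > 0], membership in the lattice [(1/q) Z^d]. *)
Definition int_mult (q : nat) (x : 'rV[rat]_(size w)) :=
  [forall h, x 0 h * q%:R \is a Num.int].

(** Indicator of [Z^d]. Using it in place of the indicator of the origin amounts to running the walk
    in [Q^d / Z^d]. *)
Let sgr x : R := (int_mult 1 x)%:R.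

Lemma realizeD x y : realize (x + y) = realize x + realize y.
Proof.
by rewrite -big_split; apply: eq_bigr => h _; rewrite mxE rmorphD mulrDl.
Qed.

Lemma realizeB x y : realize (x - y) = realize x - realize y.
Proof.
by rewrite -sumrB; apply: eq_bigr => h _; rewrite !mxE rmorphB mulrBl.
Qed.

Lemma int_multD q x y : int_mult q x -> int_mult q y -> int_mult q (x + y).
Proof.
move=> /forallP hx /forallP hy; apply/forallP => h.
by rewrite mxE mulrDl rpredD.
Qed.

Lemma int_multN q x : int_mult q (- x) = int_mult q x.
Proof. by apply/eq_forallb => h; rewrite mxE mulNr rpredN. Qed.

Lemma int_multB q x y : int_mult q x -> int_mult q y -> int_mult q (x - y).
Proof. by move=> hx hy; rewrite int_multD // int_multN. Qed.

Lemma int_multMl p q x : int_mult q x -> int_mult (p * q) x.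
Proof.
move=> /forallP hx; apply/forallP => h.
by rewrite natrM mulrCA; apply: rpredM (natr_int _ _) (hx h).
Qed.

Lemma int_mult_mulz q x (i : int) : int_mult q (x *~ i) = int_mult (`|i| * q) x.
Proof.
have E (n : nat) y : int_mult q (y *+ n) = int_mult (n * q) y.
  by apply/eq_forallb => h; rewrite mulmxnE natrM mulrA (mulr_natr (y 0 h) n).
case: i => n; first by rewrite -pmulrn E.
by rewrite NegzE mulrNz int_multN -pmulrn E abszN.
Qed.

Hypotheses (disw : dissociated Nb w)
  (ub : forall j, j \in G -> forall h, `|u j 0 h| <= N1%:R)
  (ureal : forall j, j \in G -> realize (u j) = b j)
  (uden : forall j, j \in G -> exists2 k : nat, (0 < k <= N1)%N & int_mult k (u j)).
Variables (E0 L T : nat).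
Let E := (2 * E0 * L)%N.
(** [reach] bounds the numerators over [q] of all points within [2 * T * m] steps by the
    dissociation level; [Tbig] says that [T] triplings would push [q] beyond its upper bound. *)
Hypotheses (L2 : (2 <= L)%N) (E0_gt0 : (0 < E0)%N) (muE0 : 2 <= mu * E0%:R)
  (N1m : (N1 <= m ^ L)%N)
  (reach : (N1 * m ^ (2 * c1 * E) * (2 * T * m) * N1 <= Nb)%N)
  (Tbig : (m ^ (2 * c1 * E) < 3 ^ T)%N)
  (conc0 : concentrated rem0 [::]).

(** A reachable point [x] with [realize x = 0] gives an integer relation between the [w_h] with
    coefficients [q x_h]; dissociation forces [x = 0]. The bound on [q] has a spare factor [N1]
    because the lemma is applied to a new denominator before that one is known to be small. *)
Lemma indicator_realize t us q : (size us <= t)%N -> (t <= T)%N -> {subset us <= G} ->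
    (q <= N1 * m ^ (2 * c1 * E))%N -> (forall j, j \in us -> int_mult q (u j)) ->
    (0 < q)%N ->
  rho mu (dup (blocks m (map b us))) 0 <= walk mu sgr (dup (blocks m (map u us))) 0.
Proof.
move=> ust tT usG qN usq q0.
have -> : dup (blocks m (map b us)) = map realize (dup (blocks m (map u us))).
  rewrite /dup map_cat; suff -> : blocks m (map b us) = map realize (blocks m (map u us)) by [].
  elim: us {ust usq} usG => [//|j us IH] usG.
  rewrite /blocks /= map_cat -/(blocks m _) -/(blocks m _) map_nseq ureal ?usG ?mem_head //.
  by rewrite IH // => k ku; apply: usG; rewrite inE ku orbT.
have r0 : 0 = realize 0.
  by rewrite /realize big1 // => h _; rewrite mxE rmorph0 mul0r.
rewrite /rho [X in walk _ _ _ X <= _]r0 (@walk_map R mu _ _ realize _ _ _ realize); last 2 first.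
- by move=> x v _; rewrite realizeD.
- by move=> x v _; rewrite realizeB.
have bl v : v \in dup (blocks m (map u us)) -> exists2 j, j \in us & v = u j.
  rewrite mem_cat orbb => /flattenP[l /mapP[v' /mapP[j ju ->] ->]].
  by rewrite mem_nseq => /andP[_ /eqP ->]; exists j.
have sz : (size (dup (blocks m (map u us))) <= 2 * T * m)%N.
  rewrite size_cat; have -> : size (blocks m (map u us)) = (size us * m)%N.
    by elim: us {ust usG usq bl} => //= j us IH; rewrite size_cat size_nseq IH mulSn.
  by rewrite addnn -mul2n mulnA leq_mul2r; apply/orP; right; lia.
apply: (@walk_le_in _ _ _ mu_ge0 mu_le1
  (fun k x => int_mult q x /\ forall h, `|x 0 h| <= (k * N1)%:R)).
- move=> k x v [xq xk] /bl[j ju ->]; have jG := usG _ ju; have jq := usq _ ju.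
  split; split => //; try by [apply: int_multD|apply: int_multB].
  + by move=> h; apply: le_trans (xk h) _; rewrite ler_nat mulSn leq_addl.
  + by move=> h; rewrite mxE mulSn natrD addrC; apply: le_trans (ler_normD _ _) _;
      apply: lerD => //; exact: ub.
  + by move=> h; rewrite !mxE mulSn natrD addrC; apply: le_trans (ler_normD _ _) _;
      rewrite normrN; apply: lerD => //; exact: ub.
- move=> x [xq xk]; rewrite /= /sgr ler_nat.
  case: eqP => //= x0; suff -> : int_mult 1 x by [].
  have /choice[c cE] : forall h : nat, exists z : int,
      forall h' : 'I_(size w), nat_of_ord h' = h -> x 0 h' * q%:R = z%:~R.
    move=> h; have [hw|hw] := ltnP h (size w); last first.
      by exists 0 => h' E'; have := ltn_ord h'; rewrite E' ltnNge hw.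
    have /forallP/(_ (Ordinal hw))/intrP[z zE] := xq; exists z => h' E'.
    by rewrite -zE; congr (x 0 _ * _); apply: val_inj.
  have qr0 : q%:R != 0 :> rat by rewrite pnatr_eq0 -lt0n.
  suff c0 h : (h < size w)%N -> c h = 0.
    apply/forallP => h; have := cE _ h erefl; rewrite c0 // => /eqP.
    by rewrite mulf_eq0 (negbTE qr0) orbF => /eqP ->; rewrite mul0r.
  apply: disw => // [k kw|].
    apply: leq_trans reach; rewrite -(ler_nat rat) natr_absz.
    have := cE k (Ordinal kw) erefl => /(congr1 Num.norm); rewrite intr_norm => <-.
    rewrite normrM mulrC normr_nat -mulnA natrM ler_pM ?ler_nat //.
    by apply: le_trans (xk _) _; rewrite ler_nat leq_mul2r sz orbT.
  have -> : comb w c = realize x * q%:R.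
    rewrite /comb /realize mulr_suml; apply: eq_bigr => k _.
    by rewrite -mulrzr mulrAC -(ratr_nat R q) -rmorphM (cE _ k erefl) /= ratr_int mulrC.
  by rewrite x0 mul0r.
split; last by move=> h; rewrite mxE normr0.
by apply/forallP => h; rewrite mxE mul0r.
Qed.

(** Invariant: the walk along the chosen blocks lies in [Z^d] with probability at most
    [q ^ (- 1 / E)]. Compared with the return probability [m ^ (- 2 c1)] this keeps [q] below
    [m ^ (2 c1 E)], while each stage at least triples it. *)
Lemma phase2 : exists (q : nat) (rem : {set I}),
  [/\ (0 < q)%N, (q <= m ^ (2 * c1 * E))%N, (#|~: rem| <= #|~: rem0| + T * m)%N &
    (#|[set j in rem :&: G | ~~ int_mult (2 * q) (u j)]| < m)%N].
Proof.
match goal with |- ?g => pose concl := g end.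
have E_gt0 : (0 < E)%N by rewrite !muln_gt0 E0_gt0 (leq_trans _ L2).
have sg0 x : 0 <= sgr x by rewrite /sgr ler0n.
suff H t : (t <= T)%N -> concl \/ exists (us : seq I) (rem : {set I}) (q : nat),
   [/\ [/\ size us = t, {subset us <= G}, (3 ^ t <= q)%N & (q <= m ^ (2 * c1 * E))%N],
       [/\ forall j, j \in us -> int_mult q (u j),
       #|~: rem| = (#|~: rem0| + t * m)%N & concentrated rem us],
       forall a, walk mu sgr (blocks m (map u us)) a ^+ E <= q%:R^-1 &
       forall a, walk mu sgr (blocks m (map u us)) a != 0 -> int_mult q a].
  have [//|[us [rem [q [[_ _ q1 q2] _ _ _]]]]] := H T (leqnn _).
  by have := leq_trans q1 q2; rewrite leqNgt Tbig.
elim: t => [_|t IH tT].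
  right; exists [::], rem0, 1%N; split.
  - by split => //; rewrite expn_gt0 m_gt0.
  - by split => //; rewrite mul0n addn0.
  - move=> a; rewrite invr1 /= /sgr; case: int_mult; rewrite ?expr1n //.
    by rewrite expr0n eqn0Ngt E_gt0 ler01.
  - by move=> a /=; rewrite /sgr; case: int_mult => //; rewrite eqxx.
have [cl|[us [rem [q [[sz usG q3 qm] [usq crem conc] bound supp]]]]] := IH (ltnW tT).
  by left; exact: cl.
have q0 : (0 < q)%N by apply: leq_trans q3; rewrite expn_gt0.
set B := [set j in rem :&: G | ~~ int_mult (2 * q) (u j)].
have [mB|mB] := ltnP #|B| m.
  left; exists q, rem; split => //; rewrite crem leq_add2l leq_mul2r.
  by rewrite (ltnW tT) orbT.
have Br : B \subset rem.
  by apply/fintype.subsetP => x; rewrite !inE => /andP[/andP[]].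
have [j jB [rem' [_ crem' conc']]] := concentrated_step conc Br mB.
right; move: jB; rewrite !inE => /andP[/andP[_ jG] nj].
have [k /andP[k0 kN] kj] := uden jG.
(* The least such [p] is the order of [u j] modulo [(1/q) Z^d]; it is at least 3 because [2 * q] is
   not a denominator of [u j]. *)
have exP : exists p : nat, (0 < p)%N && int_mult (p * q) (u j).
  by exists k; rewrite k0 mulnC int_multMl.
have [p /andP[p0 pj] pmin] := ex_minnP exP.
have pN : (p <= N1)%N by apply: leq_trans kN; apply: pmin; rewrite k0 mulnC int_multMl.
have p3 : (3 <= p)%N.
  rewrite ltnNge; apply: contra nj => p2; have [p1|p1] := leqP p 1%N.
    have pE : p = 1%N by apply/eqP; rewrite eqn_leq p1.
    by rewrite int_multMl //; move: pj; rewrite pE mul1n.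
  have pE : p = 2%N by apply/eqP; rewrite eqn_leq p2.
  by move: pj; rewrite pE.
have [m' /andP[mm m2p] gain] := rho_int_gain mu_ge0 mu_le1 muE0 L2
  (introT andP (conj p3 (leq_trans pN N1m))).
pose us' := j :: us; pose q' := (p * q)%N.
have blE a : walk mu sgr (blocks m (map u us')) a =
    walk mu (walk mu sgr (blocks m (map u us))) (nseq m (u j)) a.
  by rewrite /blocks /= walk_cat.
have q'0 : (0 < q')%N by rewrite muln_gt0 p0.
have usG' : {subset us' <= G}.
  by move=> x; rewrite inE => /predU1P[->//|]; apply: usG.
have usq' i : i \in us' -> int_mult q' (u i).
  by rewrite inE => /predU1P[->//|/usq]; apply: int_multMl.
have bound' a : walk mu sgr (blocks m (map u us')) a ^+ E <= q'%:R^-1.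
  rewrite blE natrM invfM mulrC; apply: (@walk_peel _ mu mu_ge0 mu_le1 _ _ _ _ E m') => //.
  - by move=> x; apply: walk_ge0.
  (* Two distinct multiples in the support would give a multiplier [|i1 - i2| <= 2 * m' < p],
     against minimality of [p]. *)
  move=> x i1 i2 i1m i2m /supp h1 /supp h2; apply/eqP/negPn/negP => ni.
  have : int_mult (`|i1 - i2| * q) (u j).
    rewrite -int_mult_mulz mulrzBr.
    have -> : u j *~ i1 - u j *~ i2 = (x + u j *~ i1) - (x + u j *~ i2).
      by rewrite opprD addrACA subrr add0r.
    exact: int_multB.
  move=> h; have := pmin `|i1 - i2|%N; rewrite h andbT absz_gt0 subr_eq0 => /(_ ni).
  by move: i1m i2m m2p; clear; lia.
have supp' a : walk mu sgr (blocks m (map u us')) a != 0 -> int_mult q' a.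
  rewrite blE => h; have [i _ /supp hi] := walk_supp_nseq mu_ge0 mu_le1 h.
  rewrite -(addrK (u j *~ i) a); apply: int_multB; first exact: int_multMl.
  by rewrite int_mult_mulz; apply: int_multMl.
have qm' : (q' <= m ^ (2 * c1 * E))%N.
  have M0 : 0 <= m%:R ^+ (2 * c1) :> R by rewrite exprn_ge0.
  have c1' : 1 <= m%:R ^+ (2 * c1) * walk mu sgr (dup (blocks m (map u us'))) 0.
    apply: le_trans conc' _; rewrite ler_wpM2l //.
    apply: le_trans (rho_dup_catr mu_ge0 mu_le1 _ _) _.
    apply: (@indicator_realize t.+1 us' q') => //; first by rewrite /= sz.
    by rewrite leq_mul.
  rewrite /dup walk_cat in c1'.
  have [y Hy] := walk_le_value mu_ge0 mu_le1 (walk mu sgr (blocks m (map u us')))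
    (blocks m (map u us')) 0.
  have c2 : 1 <= m%:R ^+ (2 * c1) * walk mu sgr (blocks m (map u us')) y.
    by apply: le_trans c1' _; rewrite ler_wpM2l.
  have : 1 <= (m%:R ^+ (2 * c1) * walk mu sgr (blocks m (map u us')) y) ^+ E.
    by rewrite exprn_ege1.
  rewrite exprMn -exprM => c3.
  have : 1 <= m%:R ^+ (2 * c1 * E) * q'%:R^-1 :> R.
    by apply: le_trans c3 _; rewrite ler_wpM2l // exprn_ge0.
  by rewrite ler_pdivlMr ?ltr0n // mul1r -natrX ler_nat.
exists us', rem', q'; split => //; last first.
  by split => //; rewrite crem' crem mulSn addnCA addnC.
split => //=; first by rewrite sz.
by rewrite expnS leq_mul.
Qed.

End Phase2.
End Phases.
End Greedy.

(** * The inverse Littlewood-Offord theorem *)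

(** Lets quantities linear in [s], such as the number of stages of the second phase, be bounded by
    [m = 2 ^ s]. *)
Lemma linear_le_exp2 a s : (4 * a <= s)%N -> (a * s.+1 <= 2 ^ s)%N.
Proof.
have H : (s.+1 * s.+1 <= 4 * 2 ^ s)%N.
  have H3 n : (n.+4 * n.+4 <= 4 * 2 ^ n.+3)%N.
    by elim: n => [//|n IH]; rewrite expnS; nia.
  by case: s => [|[|[|s]]].
by nia.
Qed.

Lemma related_coordinates (R : realFieldType) (N : nat) (w : seq R) (v : R) :
  related N w v -> exists u : 'rV[rat]_(size w),
    [/\ forall h, `|u 0 h| <= N%:R, realize u = v &
        exists2 k : nat, (0 < k <= N)%N & int_mult k u].
Proof.
case=> k [c [k0 kN cN vk]].
have k0' : k%:~R != 0 :> rat by rewrite intr_eq0.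
exists (\row_h ((c h)%:~R / k%:~R)); split.
- move=> h; rewrite mxE normrM normfV -!intr_norm ler_pdivrMr; last first.
    by rewrite ltr0z normr_gt0.
  have k1 : (1 : rat) <= `|k|%:~R by rewrite ler1z -gtz0_ge1 normr_gt0.
  apply: (@le_trans _ _ N%:R); last by rewrite ler_peMr // ler0n.
  by have := cN h (ltn_ord h); rewrite -(ler_nat rat) natr_absz intr_norm.
- have k0R : k%:~R != 0 :> R by rewrite intr_eq0.
  apply: (mulIf k0R); rewrite [RHS]mulrzr vk /realize /comb mulr_suml.
  apply: eq_bigr => h _; rewrite mxE fmorph_div /= !ratr_int -mulrzr; field; exact: k0R.
exists `|k|%N; first by rewrite absz_gt0 k0.
apply/forallP => h; rewrite mxE natr_absz.
have -> : (`|k|%:~R : rat) = k%:~R * (Num.sg k)%:~R.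
  by rewrite -intrM mulrC -normrEsg.
by rewrite mulrA divfK // -intrM intr_int.
Qed.

Section InverseLittlewoodOfford.
Variables (R : archiRealFieldType) (c1 : nat) (mu : R).
Hypotheses (mu_gt0 : 0 < mu) (mu_le1 : mu <= 1).

Lemma inverse_littlewood_offord : exists K s0 : nat, forall s, (s0 <= s)%N ->
  forall (I : finType) (b : I -> R) (a : R),
    1 <= (2 ^ s)%:R ^+ c1 * rho mu (map b (enum I)) a ->
  exists (J0 good : {set I}) (q : nat) (c : I -> I -> int),
    [/\ (#|J0| <= 8 * c1)%N, (0 < q <= (2 ^ s) ^ K)%N, (#|~: good| <= (2 ^ s) ^ 2)%N,
        forall j h, j \in good -> (`|c j h| <= (2 ^ s) ^ K)%N &
        forall j, j \in good -> b j *+ q = \sum_(h in J0) b h *~ c j h].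
Proof.
have mu_ge0 := ltW mu_gt0.
pose E0 := (Num.bound (2 / mu)).+1.
have muE0 : 2 <= mu * E0%:R.
  rewrite mulrC -ler_pdivrMr // ltW //; apply: lt_le_trans (archi_boundP _) _.
    by rewrite divr_ge0.
  by rewrite ler_nat.
(* The dissociation level at stage [d] is [m ^ Lf d]. The ratio [B] of consecutive exponents is what
   [reach] costs: [2 L] for the two factors [N1], [4 c1 E0 L] for [q], and 2, at most [L], for the
   number of steps. *)
pose B := (4 * c1 * E0 + 3)%N; pose Lf d := (2 * B ^ ((8 * c1).+1 - d))%N.
pose W := (2 * c1 * (2 * E0 * Lf 0))%N.
pose a0 := (E0 ^ 2 + 16 * c1 + 5 + 2 * W)%N.
exists (W + Lf 0 + 3)%N, (4 * a0)%N => s /linear_le_exp2 sa I b a rho_a.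
set m := (2 ^ s)%N in sa rho_a *.
have m_gt0 : (0 < m)%N by rewrite expn_gt0.
have B_gt0 : (0 < B)%N by rewrite addn_gt0 orbT.
have LfS d : (Lf d.+1 <= Lf d)%N by rewrite leq_mul2l leq_pexp2l //; lia.
have Lf0 d : (Lf d <= Lf 0)%N by rewrite leq_mul2l leq_pexp2l //; lia.
have LfB d : (d <= 8 * c1)%N -> Lf d = (B * Lf d.+1)%N.
  by move=> d8; rewrite /Lf mulnCA -expnS; congr (_ * _ ^ _)%N; lia.
have Lf2 d : (2 <= Lf d)%N by rewrite -[X in (X <= _)%N]muln1 leq_mul2l expn_gt0 B_gt0.
have ms : (a0 <= m)%N by apply: leq_trans sa; rewrite leq_pmulr.
have m1 : (1 < m)%N by apply: leq_trans ms; rewrite /a0; lia.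
have mu4 : 4 <= mu ^+ 2 * m%:R.
  have E2m : (E0 ^ 2)%:R <= m%:R :> R by rewrite ler_nat; apply: leq_trans ms; rewrite /a0; lia.
  apply: (@le_trans _ _ (mu ^+ 2 * (E0 ^ 2)%:R)); last by rewrite ler_wpM2l // sqr_ge0.
  by rewrite natrX -exprMn; have := muE0; set x := mu * _; nra.
have conc : concentrated mu b s c1 finset.setT [::].
  rewrite /concentrated /blocks /= cats0 mulnC exprM -/m.
  rewrite (_ : map b (enum (finset.setT : {set I})) = map b (enum I)); last first.
    by congr (map b _); apply: eq_enum => x; rewrite inE.
  have r0 := rho_sqr mu_ge0 mu_le1 (map b (enum I)) a.
  apply: (@le_trans _ _ ((m%:R ^+ c1 * rho mu (map b (enum I)) a) ^+ 2)).
    by rewrite exprn_ege1.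
  by rewrite exprMn ler_wpM2l // exprn_ge0 // exprn_ge0.
have lev2 : (2 * m <= m ^ Lf (8 * c1).+1)%N.
  by apply: (@leq_trans (m ^ 2)); rewrite ?leq_pexp2l // -mulnn leq_mul2r m1 orbT.
have levS d : (m ^ Lf d.+1 <= m ^ Lf d)%N by rewrite leq_pexp2l.
have [us [rem0 [usz dis crem0 conc0 nrel]]] :=
  phase1 (lev := fun d => (m ^ Lf d)%N) mu_ge0 mu_le1 m1 mu4 levS lev2 conc.
pose w := map b us; pose L := Lf (size us).+1; pose N1 := (m ^ L)%N.
pose B1 := [set j in rem0 | ~~ `[< related N1 w (b j) >] ].
have cB1 : (#|B1| < m)%N := nrel.
pose G := [set j in rem0 | `[< related N1 w (b j) >] ].
have /choice[u uP] : forall j, exists u : 'rV[rat]_(size w), j \in G ->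
    [/\ forall h, `|u 0 h| <= N1%:R, realize u = b j &
        exists2 k : nat, (0 < k <= N1)%N & int_mult k u].
  move=> j; have [jG|] := boolP (j \in G); last by exists 0.
  have := jG; rewrite inE => /andP[_ /asboolP/related_coordinates[u uP]].
  by exists u.
(* As [m = 2 ^ s], this gives [3 ^ T > m ^ (2 c1 E)] with [T] only linear in [s]. *)
pose E := (2 * E0 * L)%N; pose T := (s * (2 * c1 * E)).+1.
have EW : (2 * c1 * E <= W)%N by rewrite leq_mul2l leq_mul2l Lf0 !orbT.
have Tm : (16 * c1 + 4 + 2 * T <= m)%N.
  apply: leq_trans sa; rewrite /a0 /T.
  have : (s * (2 * c1 * E) <= s * W)%N by rewrite leq_mul2l EW orbT.
  by move: (s * _)%N => y; clear; nia.
have Tbig : (m ^ (2 * c1 * E) < 3 ^ T)%N.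
  rewrite -expnM; apply: (@leq_ltn_trans (3 ^ (s * (2 * c1 * E)))%N).
    by case: (s * _)%N => [//|e]; rewrite leq_exp2r.
  by rewrite ltn_exp2l.
have reach : (N1 * m ^ (2 * c1 * E) * (2 * T * m) * N1 <= m ^ Lf (size us))%N.
  apply: (@leq_trans (m ^ L * m ^ (2 * c1 * E) * (m * m) * m ^ L)%N).
    by rewrite !leq_mul //; move: Tm; clear; lia.
  rewrite mulnn -!expnD leq_pexp2l // LfB // -/L /E /B.
  by have := Lf2 (size us).+1; rewrite -/L; clear; nia.
have [q [rem [q0 qm crem cB]]] := phase2 mu_ge0 mu_le1 (w := w) (u := u) (G := G)
  dis (fun j jG => let: And3 h _ _ := uP j jG in h)
  (fun j jG => let: And3 _ h _ := uP j jG in h)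
  (fun j jG => let: And3 _ _ h := uP j jG in h)
  (Lf2 _) (ltn0Sn _) muE0 (leqnn _) reach Tbig conc0.
pose good := [set j in rem :&: G | int_mult (2 * q) (u j)].
have cgood : (#|~: good| <= m ^ 2)%N.
  (* An index is bad if it was used up in either phase, is unrelated to [w], or lacks the
     denominator [2 * q]. *)
  have sub : ~: good \subset (~: rem :|: (~: rem0 :|: B1))
      :|: [set j in rem :&: G | ~~ int_mult (2 * q) (u j)].
    apply/fintype.subsetP => x; rewrite !inE.
    by case: (x \in rem); case: (x \in rem0); case: `[< _ >]; case: int_mult.
  apply: leq_trans (subset_leq_card sub) _.
  apply: leq_trans (leq_card_setU _ _) _.
  apply: leq_trans (leq_add (leq_card_setU _ _) (leqnn _)) _.
  apply: leq_trans (leq_add (leq_add (leqnn _) (leq_card_setU _ _)) (leqnn _)) _.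
  have h1 : (size us * m <= 8 * c1 * m)%N by rewrite leq_mul2r usz orbT.
  rewrite -mulnn; apply: (@leq_trans ((16 * c1 + T + 2) * m)%N); last first.
    by rewrite leq_mul2r; apply/orP; right; move: Tm; clear; lia.
  rewrite -/m in crem; move: crem (leq_trans crem0 h1) cB cB1.
  move: #|_| #|_| #|_| #|B1| (T) => x1 x2 x3 x4 x5; clear; nia.
have /choice[z zP] : forall j, exists z : 'I_(size w) -> int, j \in good ->
    forall h, u j 0 h * (2 * q)%:R = (z h)%:~R.
  move=> j; have [jg|] := boolP (j \in good); last by exists (fun=> 0).
  have := jg; rewrite inE => /andP[_ /forallP H].
  have /choice[z zP] : forall h, exists z : int, u j 0 h * (2 * q)%:R = z%:~R.
    by move=> h; apply/intrP.
  by exists z.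
(* The coefficient of [i] collects all positions of [us] holding [i], since the entries of [us] are
   not known here to be distinct. *)
exists [set x in us], good, (2 * q)%N,
  (fun j i => \sum_(h < size w | nth i us h == i) z j h).
have zb j h : j \in good -> (`|z j h| <= 2 * q * N1)%N.
  move=> jg; rewrite -(ler_nat rat) natr_absz intr_norm -(zP j jg h) normrM normr_nat.
  rewrite (natrM _ (2 * q)) [leLHS]mulrC ler_wpM2l //; have := jg; rewrite !inE => /andP[/andP[_ jG] _].
  by have /uP[] : j \in G by rewrite inE.
have q2m : (2 * q <= m ^ W.+1)%N.
  by rewrite expnS leq_mul //; apply: leq_trans qm _; rewrite leq_pexp2l.
split => //.
- by apply: leq_trans usz; rewrite cardsE card_size.
- rewrite muln_gt0 q0 /=; apply: leq_trans q2m _; rewrite leq_pexp2l //; move: (W) (Lf 0%N); clear; lia.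
- move=> j i jg; apply: (@leq_trans (\sum_(h < size w) (2 * q * N1))%N); last first.
    rewrite sum_nat_const card_ord size_map.
    apply: (@leq_trans (m * (m ^ W.+1 * m ^ Lf 0))%N).
      rewrite !leq_mul //; first by move: usz ms; rewrite /a0; clear; lia.
      by rewrite leq_pexp2l // Lf0.
    by rewrite -expnD -expnS leq_pexp2l //; move: (W) (Lf 0%N); clear; lia.
  apply: (@leq_trans (\sum_(h < size w | nth i us h == i) `|z j h|)%N).
    by elim/big_ind2: _ => // x1 x2 y1 y2; clear; lia.
  rewrite [leqRHS](bigID (fun h : 'I__ => nth i us h == i)) /=.
  by apply: leq_trans (leq_addr _ _); apply: leq_sum => h _; apply: zb.
move=> j jg; have := jg; rewrite inE => /andP[]; rewrite inE => /andP[_ jG] _.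
have [_ <- _] := uP j jG; rewrite /realize -sumrMnl.
under [RHS]eq_bigr => i _ do rewrite mulrz_sumr.
have ltus (h : 'I_(size w)) : (h < size us)%N by rewrite -(size_map b us) ltn_ord.
rewrite (partition_big (fun h : 'I_(size w) => nth j us h) (mem us)) /=; last first.
  by move=> h _; apply: mem_nth.
apply: eq_big => [i|i ius]; first by rewrite inE.
have nthE (h : 'I_(size w)) : nth i us h = nth j us h.
  by apply: set_nth_default.
apply: eq_big => [h|h /eqP hi]; first by rewrite nthE.
have -> : w`_h = b i.
  by rewrite /w (nth_map j) ?hi.
rewrite -mulrzr -[LHS]mulr_natr mulrAC -(ratr_nat R (2 * q)) -rmorphM zP //=.
by rewrite ratr_int mulrC.
Qed.

End InverseLittlewoodOfford.

(** * Bilinear forms over finitely many sign patterns *)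

Lemma sum_pigeonhole (R : realFieldType) (S T : finType) (P : pred S) (key : S -> T) (w : S -> R) :
    (exists t : T, true) -> exists t, \sum_(x | P x) w x <= #|T|%:R * \sum_(x | P x && (key x == t)) w x.
Proof.
move=> [t0 _]; apply: contrapT => none.
have lt t : \sum_(x | P x && (key x == t)) w x < (\sum_(x | P x) w x) / #|T|%:R.
  have T0 : 0 < #|T|%:R :> R by rewrite ltr0n; apply/card_gt0P; exists t0.
  rewrite ltr_pdivlMr // mulrC ltNge; apply/negP => h; apply: none; by exists t.
have : \sum_(x | P x) w x < \sum_(x | P x) w x.
  rewrite {1}(partition_big key xpredT) //=.
  apply: (@lt_le_trans _ _ (\sum_(t : T) (\sum_(x | P x) w x) / #|T|%:R)).
    by apply: ltr_sum => [|t _]; [apply/hasP; exists t0; rewrite ?mem_index_enum | apply: lt].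
  rewrite sumr_const -[(_ / _) *+ _]mulr_natr divfK // pnatr_eq0 -lt0n; apply/card_gt0P; by exists t0.
by rewrite ltxx.
Qed.

(** * Sign vectors as tuples over three symbols *)

Section SignModel.
Variables (R : archiRealFieldType) (mu : R).

Definition sgn3 (i : 'I_3) : R := i%:R - 1.
Definition wt3 (i : 'I_3) : R := if i == 1%N :> nat then 1 - mu else mu / 2.
Definition wt n (x : n.-tuple 'I_3) : R := \prod_(i < n) wt3 (tnth x i).

Lemma sum_tupleS n (F : n.+1.-tuple 'I_3 -> R) :
  \sum_x F x = \sum_(i < 3) \sum_(x : n.-tuple 'I_3) F [tuple of i :: x].
Proof.
rewrite pair_big /=.
rewrite (reindex (fun p : 'I_3 * n.-tuple 'I_3 => [tuple of p.1 :: p.2])) //=.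
exists (fun x => (thead x, behead_tuple x)) => [[i x] _|x _] /=.
  by congr pair; apply: val_inj.
by rewrite [RHS]tuple_eta; apply: val_inj.
Qed.

Lemma sum_wt_walk n (b : 'I_n -> R) (f : R -> R) a :
  \sum_(x : n.-tuple 'I_3) wt x * f (a + \sum_i b i * sgn3 (tnth x i)) =
  walk mu f (map b (enum 'I_n)) a.
Proof.
elim: n b a => [|n IH] b a.
  rewrite (eq_bigr (fun=> f a)) => [|x _]; last by rewrite /wt !big_ord0 mul1r addr0.
  have -> : enum 'I_0 = [::] by apply: size0nil; rewrite size_enum_ord.
  by rewrite sumr_const card_tuple expn0 mulr1n.
rewrite enum_ordSl /= -map_comp sum_tupleS.
have E i : \sum_(x : n.-tuple 'I_3) wt [tuple of i :: x] *
      f (a + \sum_j b j * sgn3 (tnth [tuple of i :: x] j)) =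
    wt3 i * walk mu f (map (b \o lift ord0) (enum 'I_n)) (a + b ord0 * sgn3 i).
  rewrite -IH mulr_sumr; apply: eq_bigr => x _.
  rewrite /wt !big_ord_recl /= !tnth0 -mulrA; congr (_ * (_ * f _)).
    by apply: eq_bigr => j _; rewrite tnthS.
  rewrite addrA; congr (_ + _); by apply: eq_bigr => j _; rewrite tnthS.
rewrite !big_ord_recl big_ord0 addr0 !E /wt3 /sgn3 /= /bump /=.
have -> : (1 + 0)%:R - 1 = 0 :> R by rewrite addn0 subrr.
have -> : (1 + (1 + 0))%:R - 1 = 1 :> R by rewrite addn0 natrD addrK.
by rewrite sub0r mulr0 addr0 mulrN1 mulr1; ring.
Qed.

Hypotheses (mu_gt0 : 0 < mu) (mu_le1 : mu <= 1).

Lemma wt_ge0 n (x : n.-tuple 'I_3) : 0 <= wt x.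
Proof.
apply: prodr_ge0 => i _; rewrite /wt3; case: ifP => _; first by rewrite subr_ge0.
by rewrite divr_ge0 // ltW.
Qed.

Lemma sum_wt n : \sum_(x : n.-tuple 'I_3) wt x = 1.
Proof.
have := sum_wt_walk (fun _ : 'I_n => 0) (fun=> 1) 0; rewrite walk_const => <-.
by apply: eq_bigr => x _; rewrite mulr1.
Qed.

(** The set [J0] becomes a list of fixed length padded with [None], so that only [(n + 1) ^ (8 c1)]
    choices occur and the pigeonhole principle applies to them. *)
Lemma inverse_littlewood_offord_enum (c1 : nat) : exists K s0 : nat, forall s, (s0 <= s)%N ->
  forall n (b : 'I_n -> R) (a : R),
    1 <= (2 ^ s)%:R ^+ c1 * rho mu (map b (enum 'I_n)) a ->
  exists (f : {ffun 'I_(8 * c1) -> option 'I_n}) (good : {set 'I_n}) (q : nat)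
      (z : 'I_n -> 'I_(8 * c1) -> int),
    [/\ (0 < q <= (2 ^ s) ^ K)%N, (#|~: good| <= (2 ^ s) ^ 2)%N,
        forall j t, j \in good -> (`|z j t| <= (2 ^ s) ^ K)%N &
        forall j, j \in good -> b j *+ q = \sum_t oapp b 0 (f t) *~ z j t].
Proof.
have [K [s0 H]] := inverse_littlewood_offord c1 mu_gt0 mu_le1.
exists K, s0 => s ss n b a /(H s ss)[J0 [good [q [c [J0c qK gc cK cE]]]]].
pose e := map Some (enum J0).
have se : size e = #|J0| by rewrite size_map -cardE.
exists [ffun t : 'I_(8 * c1) => nth None e t], good, q,
  (fun j t => if nth None e t is Some h then c j h else 0); split => //.
  by move=> j t jg; case: (nth _ _ _) => [h|]; [apply: cK | ].
move=> j jg; rewrite (cE j jg) -big_enum /=.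
rewrite -(big_map Some xpredT (fun o => oapp b 0 o *~ (if o is Some h then c j h else 0))) -/e.
rewrite (big_nth None) big_mkord se. 
rewrite (big_ord_widen (8 * c1) (fun i => oapp b 0 (nth None e i) *~
  (if nth None e i is Some h then c j h else 0)) J0c) big_mkcond /=.
apply: eq_bigr => t _; rewrite ffunE; case: ltnP => // h.
by rewrite nth_default ?se // mul0rz.
Qed.

End SignModel.

(** * Structured columns after multiplication on one side *)

Section OneSide.
Variables (R : archiRealFieldType) (c1 e : nat).
Let D := (8 * c1.+1)%N.

(** The entries of [v] over [S] lie in a symmetric GAP, so far without properness. *)
Definition col_structured (m K n : nat) (v : 'I_n -> R) (S : {set 'I_n}) :=
  exists r (g : 'I_r -> R), (r <= K)%N /\ forall i, i \in S ->
    exists2 c : 'I_r -> int, forall h, (`|c h| <= m ^ K)%N & v i = \sum_h g h *~ c h.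

Lemma column_structure (mu : R) : 0 < mu <= 1 -> exists K s0 : nat, forall s, (s0 <= s)%N ->
  forall n (A : 'I_n -> 'I_n -> R) (a : R), (n < (2 ^ s) ^ e)%N ->
    1 <= (2 ^ s)%:R ^+ c1 * \sum_(x : n.-tuple 'I_3) wt mu x *
       rho mu (map (fun j => \sum_i A i j * sgn3 R (tnth x i)) (enum 'I_n)) a ->
  exists (J0 good : {set 'I_n}) (q : nat) (ll : 'I_n -> 'I_n -> int),
    [/\ (#|J0| <= D)%N /\ (0 < q <= (2 ^ s) ^ K)%N, (#|~: good| <= 2 * (2 ^ s) ^ 2)%N,
        forall h j, (`|ll h j| <= (2 ^ s) ^ K)%N &
        forall j, j \in good -> exists2 S : {set 'I_n}, (#|~: S| <= (2 ^ s) ^ 2)%N &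
          col_structured (2 ^ s) K (fun i => A i j *+ q + \sum_(h in J0) A i h *~ ll h j) S].
Proof.
case/andP=> mu_gt0 mu_le1; have mu_ge0 := ltW mu_gt0.
have wt0 := fun n => @wt_ge0 R mu mu_gt0 mu_le1 n.
have [K1 [s1 H1]] := inverse_littlewood_offord_enum mu_gt0 mu_le1 c1.+1.
(* Powers of [m] lost in turn: restriction to the rich [x], choice of the basis and of the
   denominator, a factor 2 for the good columns, and choice of the [D] numerators. *)
pose c2 := (c1.+1 + (D * e + K1.+1).+1 + (K1.+2 * D))%N.
have [K2 [s2 H2]] := inverse_littlewood_offord_enum mu_gt0 mu_le1 c2.
exists (K1 + 8 * c2 + K2 + D).+1, (s1 + s2 + D).+1 => s ss n A a nm Hr.
set m := (2 ^ s)%N in nm Hr *.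
have m_gt0 : (0 < m)%N by rewrite expn_gt0.
have m1 : (1 < m)%N by rewrite -[X in (X < _)%N](expn0 2) ltn_exp2l //; move: ss; clear; lia.
have Dm : (D <= m)%N by apply: (@leq_trans s); [move: ss; clear; lia | rewrite ltnW // ltn_expl].
have mR0 k : 0 < m%:R ^+ k :> R by rewrite exprn_gt0 // ltr0n.
have mR2 : 2 <= m%:R :> R by rewrite ler_nat.
pose b (x : n.-tuple 'I_3) j := \sum_i A i j * sgn3 R (tnth x i).
pose p x := rho mu (map (b x) (enum 'I_n)) a.
pose G := [pred x | 1 <= m%:R ^+ c1.+1 * p x].
have p1 x : p x <= 1 by apply: walk_ub => // y; rewrite lern1 leq_b1.
(* The [x] outside [G] contribute at most [m ^ (- (c1 + 1))], at most half of the total. *)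
have GG : 1 <= m%:R ^+ c1.+1 * \sum_(x | G x) wt mu x.
  have h : \sum_x wt mu x * p x <= \sum_(x | G x) wt mu x + (m%:R ^+ c1.+1)^-1.
    rewrite (bigID G) /= lerD //.
      by apply: ler_sum => x _; rewrite ler_piMr // wt0.
    have -> : (m%:R ^+ c1.+1)^-1 = \sum_(x : n.-tuple 'I_3) wt mu x / m%:R ^+ c1.+1 :> R.
      by rewrite -mulr_suml sum_wt mul1r.
    rewrite [leRHS](bigID G) /=.
    rewrite -[leLHS]add0r lerD //.
      apply: sumr_ge0 => x _; apply: mulr_ge0; first exact: wt0.
      by rewrite invr_ge0; exact: ltW (mR0 _).
    apply: ler_sum => x; rewrite -ltNge => /ltW hx; rewrite ler_wpM2l ?wt0 //.
    by rewrite -div1r ler_pdivlMr // mulrC.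
  have h2 : 1 <= m%:R ^+ c1 * (\sum_(x | G x) wt mu x + (m%:R ^+ c1.+1)^-1).
    by apply: le_trans Hr _; rewrite ler_wpM2l // ltW.
  move: h2; rewrite mulrDr exprS invfM mulrCA divff ?gt_eqF // mulr1 -mulrA.
  set y := _ * \sum_(_ | _) _ => h2.
  have mi : m%:R * m%:R^-1 = 1 :> R by rewrite divff // gt_eqF // (lt_le_trans _ mR2).
  have : 1 <= m%:R * 2^-1 :> R by lra.
  have iv : m%:R^-1 <= 2^-1 :> R by rewrite lef_pV2 // posrE // (lt_le_trans _ mR2).
  have y2 : 2^-1 <= y by lra.
  by nra.
have /choice[d dP] : forall x, exists d : {ffun 'I_D -> option 'I_n} * nat * {set 'I_n} *
     ('I_n -> 'I_D -> int), G x ->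
   [/\ (0 < d.1.1.2 <= m ^ K1)%N, (#|~: d.1.2| <= m ^ 2)%N,
        forall j t, j \in d.1.2 -> (`|d.2 j t| <= m ^ K1)%N &
        forall j, j \in d.1.2 -> b x j *+ d.1.1.2 = \sum_t oapp (b x) 0 (d.1.1.1 t) *~ d.2 j t].
  move=> x; have [Gx|nG] := boolP (G x); last first.
    by exists ([ffun=> None], 0%N, finset.set0, fun _ _ => 0) => Gx; case/negP: nG.
  have [f [good [q [z h]]]] := H1 s (leq_trans (leq_addr _ _) (leq_trans (leq_addr _ _) (ltnW ss)))
    n (b x) a Gx.
  by exists (f, q, good, z).
(* Only the basis and the denominator are made common to all columns; the numerators of all [n]
   columns together would have too many values and are fixed later, one column at a time. *)
pose key x : {ffun 'I_D -> option 'I_n} * 'I_(m ^ K1).+1 := ((d x).1.1.1, inord (d x).1.1.2).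
have [[f q'] Hk] := sum_pigeonhole G key (@wt R mu n) (ex_intro _ ([ffun=> None], ord0) isT).
pose q : nat := q'; pose G' := [pred x | G x && (key x == (f, q'))].
have G'P x : G' x -> [/\ G x, (d x).1.1.1 = f & (d x).1.1.2 = q].
  case/andP=> Gx /eqP[<- e2]; split => //; rewrite /q -e2 inordK // ltnS.
  by have [/andP[]] := dP x Gx.
pose pi' := \sum_(x | G' x) wt mu x.
have pi'E : 1 <= m%:R ^+ (c1.+1 + (D * e + K1.+1)) * pi'.
  apply: le_trans GG _; rewrite exprD -mulrA ler_wpM2l ?(ltW (mR0 _)) //.
  apply: le_trans Hk _; rewrite -/pi' ler_wpM2r ?sumr_ge0 //.
  rewrite card_prod card_ffun !card_ord card_option card_ord -natrX ler_nat expnD.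
  rewrite leq_mul //; first by rewrite mulnC expnM leq_exp2r.
  rewrite expnS; have := expn_gt0 m K1; rewrite m_gt0 /=; move: m1; clear.
  by move: (m ^ K1)%N => y; nia.
have pi'0 : 0 < pi'.
  rewrite lt0r sumr_ge0 ?andbT => [|x _]; last exact: wt0.
  by apply/eqP => E; move: pi'E; rewrite E mulr0 ler10.
have q0 : (0 < q <= m ^ K1)%N.
  have [x Gx] : exists x, G' x.
    apply: contrapT => none; move: pi'0; rewrite /pi' big_pred0 ?ltxx // => x.
    by apply/negP => Gx; apply: none; exists x.
  by have [Gx0 _ <-] := G'P x Gx; have [] := dP x Gx0.
(* Columns that are exceptional for at most half of the weight. Each [x] has at most [m ^ 2]
   exceptional columns, so double counting leaves at most [2 * m ^ 2] others. *)
pose good := [set j | \sum_(x | G' x && (j \notin (d x).1.2)) wt mu x <= pi' / 2].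
have cgood : (#|~: good| <= 2 * m ^ 2)%N.
  rewrite -(ler_nat R) -(ler_pM2r (divr_gt0 pi'0 (ltr0n R 2))).
  apply: (@le_trans _ _ (\sum_j \sum_(x | G' x && (j \notin (d x).1.2)) wt mu x)).
    rewrite (bigID (mem (~: good))) /= -[leLHS]addr0 lerD //; last first.
      by apply: sumr_ge0 => j _; apply: sumr_ge0 => x _; exact: wt0.
    rewrite mulr_natl -sumr_const; apply: ler_sum => j; rewrite !inE -ltNge; exact: ltW.
  under eq_bigr => j _ do rewrite big_mkcondr.
  rewrite exchange_big /=; apply: (@le_trans _ _ (\sum_(x | G' x) wt mu x * (m ^ 2)%:R)).
    apply: ler_sum => x G'x; rewrite -big_mkcond sumr_const -[leLHS]mulr_natr ler_wpM2l ?wt0 //.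
    rewrite ler_nat; have [Gx _ _] := G'P x G'x; have [_ h _ _] := dP x Gx.
    apply: leq_trans h; apply: subset_leq_card; apply/fintype.subsetP => j.
    by rewrite !inE.
  by rewrite -mulr_suml -/pi' natrM; lra.
have Hj j : exists z : 'I_D -> int, (forall t, (`|z t| <= m ^ K1)%N) /\ (j \in good ->
    1 <= m%:R ^+ c2 * rho mu (map (fun i => A i j *+ q -
       \sum_t oapp (A i) 0 (f t) *~ z t) (enum 'I_n)) 0).
  have [jg|] := boolP (j \in good); last by exists (fun=> 0).
  pose G2 := [pred x | G' x && (j \in (d x).1.2)].
  have G2E : pi' / 2 <= \sum_(x | G2 x) wt mu x.
    have E : pi' = \sum_(x | G2 x) wt mu x + \sum_(x | G' x && (j \notin (d x).1.2)) wt mu x.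
      by rewrite /pi' (bigID (fun x => j \in (d x).1.2)).
    by move: jg E; rewrite inE; lra.
  pose key2 x : {ffun 'I_D -> 'I_(2 * m ^ K1).+1} :=
    [ffun t => inord (absz ((d x).2 j t + (m ^ K1)%N%:Z))].
  have [k2 Hk2] := sum_pigeonhole G2 key2 (@wt R mu n) (ex_intro _ [ffun=> ord0] isT).
  pose z (t : 'I_D) : int := (k2 t)%:Z - (m ^ K1)%N%:Z.
  exists z; split => [t|_].
    rewrite /z; have := ltn_ord (k2 t).
    by set u := nat_of_ord _; set v := (m ^ K1)%N; clearbody u v; clear; lia.
  have zP x : G2 x -> key2 x == k2 -> forall t, (d x).2 j t = z t.
    case/andP=> /G'P[Gx _ _] jx /eqP kx t; rewrite /z -kx ffunE.
    have [_ _ /(_ j t jx) h _] := dP x Gx.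
    have [h1 h2] : 0 <= (d x).2 j t + (m ^ K1)%N%:Z /\
        (absz ((d x).2 j t + (m ^ K1)%N%:Z)%R < (2 * m ^ K1).+1)%N.
      by move: h; move: ((d x).2 j t) (m ^ K1)%N => u v; clear; lia.
    by rewrite inordK // gez0_abs // addrK.
  have rhoE : \sum_(x | G2 x && (key2 x == k2)) wt mu x <=
      rho mu (map (fun i => A i j *+ q - \sum_t oapp (A i) 0 (f t) *~ z t) (enum 'I_n)) 0.
    rewrite /rho -sum_wt_walk [leRHS](bigID (fun x => G2 x && (key2 x == k2))) /=.
    rewrite -[leLHS]addr0 lerD //; last first.
      by apply: sumr_ge0 => x _; rewrite mulr_ge0 ?wt0.
    apply: ler_sum => x /andP[G2x kx].
    (* All [x] of the class satisfy the same relation for column [j], so they are orthogonal to one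
       fixed combination of columns. *)
    suff -> : 0 + \sum_i (A i j *+ q - \sum_t oapp (A i) 0 (f t) *~ z t) * sgn3 R (tnth x i) = 0.
      by rewrite eqxx mulr1.
    have /andP[/G'P[Gx fx qx] jx] := G2x; have [_ _ _ /(_ j jx)] := dP x Gx.
    rewrite fx qx => E; apply/eqP; rewrite add0r.
    under eq_bigr => i _ do rewrite mulrBl mulrnAl mulr_suml.
    rewrite sumrB sumrMnl -/(b x j) E exchange_big /= subr_eq0; apply/eqP.
    apply: eq_bigr => t _; rewrite (zP x G2x kx t); case: (f t) => [h|] /=.
      by rewrite /b mulrz_suml; apply: eq_bigr => i _; rewrite mulrzAl.
    by rewrite mul0rz big1 // => i _; rewrite mul0r.
  apply: (@le_trans _ _ (m%:R ^+ c2 * \sum_(x | G2 x && (key2 x == k2)) wt mu x)); last first.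
    by rewrite ler_wpM2l // ltW.
  have c2E : c2 = (c1.+1 + (D * e + K1.+1) + 1 + K1.+2 * D)%N by rewrite /c2 addn1 !addnS.
  rewrite c2E exprD -mulrA.
  apply: (@le_trans _ _ (m%:R ^+ (c1.+1 + (D * e + K1.+1) + 1) * (pi' / 2))).
    rewrite addn1 exprS -mulrA mulrCA; move: pi'E; set y := _ * pi'.
    rewrite (_ : _ * (m%:R * (pi' / 2)) = m%:R / 2 * y); last by rewrite /y; ring.
    by nra.
  rewrite ler_wpM2l ?(ltW (mR0 _)) //; apply: le_trans G2E _; apply: le_trans Hk2 _.
  rewrite ler_wpM2r ?sumr_ge0 //.
  rewrite card_ffun !card_ord -natrX ler_nat expnM.
  rewrite leq_exp2r; last by rewrite muln_gt0.
  rewrite !expnS; have := expn_gt0 m K1; rewrite m_gt0 /=; move: m1; clear.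
  move: (m ^ K1)%N => y m1 y0; apply: (@leq_trans (2 * (2 * y))%N); first by lia.
  by rewrite leq_mul // leq_mul.
have /choice[z zP] := Hj.
exists [set h | [exists t, f t == Some h]], good, q,
  (fun h j => - \sum_(t | f t == Some h) z j t); split => //.
- split; last first.
    case/andP: q0 => -> /= q1; apply: leq_trans q1 _; rewrite leq_pexp2l //; clear; lia.
  have [->|/finset.set0Pn[h0 _]] := eqVneq [set h | [exists t, f t == Some h]] finset.set0.
    by rewrite cards0.
  have sub : [set h | [exists t, f t == Some h]] \subset [set odflt h0 (f t) | t in 'I_D].
    apply/fintype.subsetP => h; rewrite inE => /existsP[t /eqP ft].
    by apply/imsetP; exists t => //; rewrite ft.
  apply: leq_trans (subset_leq_card sub) _; apply: leq_trans (leq_imset_card _ _) _.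
  by rewrite card_ord.
- move=> h j; rewrite abszN; apply: (@leq_trans (\sum_(t | f t == Some h) `|z j t|)%N).
    by elim/big_ind2: _ => // x1 x2 y1 y2; clear; lia.
  apply: (@leq_trans (\sum_(t < D) (m ^ K1))%N).
    rewrite [leqRHS](bigID (fun t => f t == Some h)) /=.
    by apply: leq_trans (leq_addr _ _); apply: leq_sum => t _; have [] := zP j.
  rewrite sum_nat_const card_ord; apply: (@leq_trans (m * m ^ K1)%N).
    by rewrite leq_mul.
  by rewrite -expnS leq_pexp2l //; clear; lia.
move=> j jg; have [zK /(_ jg) Hz] := zP j.
have ss2 : (s2 <= s)%N by move: ss; clear; lia.
have [f2 [S [q2 [c [q2K cS cK cE]]]]] := H2 s ss2 n _ 0 Hz.
exists S => //; set v := fun i => _ in Hz cE.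
have vE i : A i j *+ q + \sum_(h in [set h | [exists t, f t == Some h]])
    A i h *~ (- \sum_(t | f t == Some h) z j t) = v i.
  rewrite /v; congr (_ + _); rewrite -sumrN.
  under eq_bigr => h _ do rewrite mulrNz mulrz_sumr -sumrN.
  rewrite (exchange_big_dep xpredT) //=; apply: eq_bigr => t _.
  case ft: (f t) => [h|] /=.
    rewrite (big_pred1 h) => [|h'] /=; first by [].
    apply/idP/idP => [/andP[_ /eqP[->]]|/eqP->] /=; first by rewrite eqxx.
    by rewrite inE eqxx andbT; apply/existsP; exists t; rewrite ft.
  by rewrite mul0rz oppr0 big_pred0 // => h; rewrite andbF.
have q20 : q2%:R != 0 :> R by rewrite pnatr_eq0; case/andP: q2K; case: (q2).
exists (8 * c2)%N, (fun t => oapp v 0 (f2 t) / q2%:R); split; first by clear; lia.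
move=> i iS; exists (c i).
  move=> t; apply: leq_trans (cK i t iS) _; rewrite leq_pexp2l //; clear; lia.
rewrite vE; apply: (mulIf q20); rewrite mulr_natr (cE i iS) mulr_suml.
by apply: eq_bigr => t _; rewrite -mulrzAl divfK.
Qed.

End OneSide.

(** * Proper progressions *)

Local Open Scope classical_set_scope.
Local Open Scope card_scope.
Local Open Scope ring_scope.

(* A relation [\sum_h c h g_h = 0] with [c p != 0] lets one drop the generator
   [g_p], at the price of dividing the others by [c p] and squaring the
   coefficients. *)
Lemma proper_generators (R : numFieldType) (m k r : nat) (g : 'I_r -> R) : (2 <= m)%N ->
  exists (r' : nat) (g' : 'I_r' -> R) (N : nat),
    [/\ (r' <= r)%N, (N <= m ^ ((k + 2) * 2 ^ r))%N,
        forall c : 'I_r' -> int, (forall h, (`|c h| <= 2 * N)%N) ->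
          \sum_h g' h *~ c h = 0 -> forall h, c h = 0 &
        forall c : 'I_r -> int, (forall h, (`|c h| <= m ^ k)%N) ->
          exists c' : 'I_r' -> int, (forall h, (`|c' h| <= N)%N) /\
            \sum_h g h *~ c h = \sum_h g' h *~ c' h].
Proof.
move=> m2; elim: r k g => [|r IH] k g.
  exists 0%N, g, (m ^ k)%N; split => //.
  - by rewrite leq_exp2l //; nia.
  - by move=> c _ _ [].
  by move=> c cm; exists c.
have [[c [cN c0 [p cp]]]|none] := pselect (exists c : 'I_r.+1 -> int,
    [/\ forall h, (`|c h| <= 2 * m ^ k)%N, \sum_h g h *~ c h = 0 & exists p, c p != 0]);
    last first.
  exists r.+1, g, (m ^ k)%N; split => //.
  - by rewrite leq_exp2l //; have := expn_gt0 2 r.+1; nia.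
  - move=> c cN c0 h; apply/eqP/negPn/negP => ch; apply: none.
    by exists c; split => //; exists h.
  by move=> c cm; exists c.
have cpR : (c p)%:~R != 0 :> R by rewrite intr_eq0.
(* The new coefficients are at most [4 * m ^ (2 k) <= m ^ (2 k + 2)], and
   [(2 k + 2) + 2 = 2 (k + 2)] reproduces the exponent [(k + 2) * 2 ^ r]. *)
have [r' [g' [N [rr Nm ind rep]]]] := IH (2 * k + 2)%N (fun h => g (lift p h) / (c p)%:~R).
exists r', g', N; split => //; first exact: leqW.
  by apply: leq_trans Nm _; rewrite leq_exp2l // expnS; lia.
move=> e em.
have [h|e' [e'N e'E]] := rep (fun h => e (lift p h) * c p - e p * c (lift p h)).
  have := em (lift p h); have := em p; have := cN p; have := cN (lift p h).
  have -> : (m ^ (2 * k + 2) = m ^ 2 * (m ^ k * m ^ k))%N.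
    by rewrite -!expnD; congr (_ ^ _)%N; lia.
  have : (4 <= m ^ 2)%N by rewrite -[4%N]/(2 ^ 2)%N leq_exp2r.
  move: (m ^ k)%N (m ^ 2)%N (e (lift p h)) (c p) (e p) (c (lift p h)) => u v x y z w.
  clear; move=> v4 h1 h2 h3 h4.
  apply: leq_trans (leqD_dist _ 0 _) _; rewrite subr0 sub0r abszN !abszM.
  apply: (@leq_trans (4 * (u * u))%N); last by rewrite leq_mul2r v4 orbT.
  have := leq_mul h4 h2; have := leq_mul h3 h1; lia.
exists e'; split => //; rewrite -e'E.
apply: (mulIf cpR); rewrite !mulr_suml (bigD1_ord p) //= [RHS](eq_bigr (fun h =>
   g (lift p h) *~ e (lift p h) * (c p)%:~R - g (lift p h) *~ c (lift p h) * (e p)%:~R)).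
  rewrite sumrB -!mulr_suml; move: c0; rewrite (bigD1_ord p) //= => /eqP.
  rewrite addrC addr_eq0 => /eqP ->; rewrite -(mulrzr (g p) (e p)) -(mulrzr (g p) (c p)).
  move: (\sum_(i < r) _) ((c p)%:~R : R) ((e p)%:~R : R) (g p) => S x y z; clear.
  by rewrite mulNr opprK mulrAC addrC.
move=> h _; rewrite -(mulrzr (g _ / _)) -(mulrzr (g _) (e _)) -(mulrzr (g _) (c _)).
rewrite rmorphB !rmorphM /=.
move: (g _) ((e (lift p h))%:~R : R) ((c p)%:~R : R) ((e p)%:~R : R) ((c (lift p h))%:~R : R) cpR.
by clear => x y z u v z0; field.
Qed.

(** Two representations differ by a relation of height [2 * N], which [proper_generators] excludes;
    the size is at most [(2 * N + 1) ^ r']. *)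
Lemma small_proper_gap_of_generators (R : realType) (m k K r n : nat) (g : 'I_r -> R) (B : set R) :
    (2 <= m <= n)%N -> (r <= K)%N -> (((k + 2) * 2 ^ r + 2) * r <= K)%N ->
    (forall x, B x -> exists2 c : 'I_r -> int, forall h, (`|c h| <= m ^ k)%N &
      x = \sum_h g h *~ c h) ->
  in_small_proper_gap K n B.
Proof.
move=> /andP[m2 mn] rK kK Bg.
have [r' [g' [N [rr Nm ind rep]]]] := proper_generators k g m2.
exists (@SymGAP R r' g' (fun=> N)); split => //=.
- move=> c e /set_mem cN /set_mem eN E; apply/funext => h; apply/eqP.
  rewrite -subr_eq0; apply/eqP; apply: (ind (fun h => c h - e h)) => [h'|].
    have h1 : (`|c h'| <= N)%N := cN h'; have h2 : (`|e h'| <= N)%N := eN h'.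
    by move: h1 h2; clear; move: (c h') (e h') => u v; lia.
  rewrite (eq_bigr (fun h => (c h)%:~R * g' h - (e h)%:~R * g' h)) => [|h' _].
    by rewrite sumrB; apply/eqP; rewrite subr_eq0; apply/eqP; exact: E.
  by rewrite -mulrzr rmorphB /=; ring.
- exact: leq_trans rr rK.
- pose F (f : {ffun 'I_r' -> 'I_(2 * N).+1}) := \sum_h ((f h)%:Z - N%:Z)%:~R * g' h.
  pose s := map F (enum {ffun 'I_r' -> 'I_(2 * N).+1}).
  apply: (@card_le_trans _ _ _ `I_(size s)); last first.
    rewrite card_le_II size_map -cardE card_ffun !card_ord.
    apply: (@leq_trans ((m ^ ((k + 2) * 2 ^ r + 2)) ^ r')%N).
      case: (r') => [//|r'']; rewrite leq_exp2r // expnD.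
      have : (4 <= m ^ 2)%N by rewrite -[4%N]/(2 ^ 2)%N leq_exp2r.
      have := expn_gt0 m ((k + 2) * 2 ^ r); rewrite (ltnW m2) /=; move: Nm.
      by move: (m ^ ((k + 2) * 2 ^ r))%N (m ^ 2)%N => u v; clear; nia.
    rewrite -expnM; apply: (@leq_trans (m ^ K)%N).
      by rewrite leq_exp2l //; apply: leq_trans kK; rewrite leq_mul2l rr orbT.
    by case: (K) => [//|K']; rewrite leq_exp2r.
  apply: (@card_le_trans _ _ _ [set nth 0 s i | i in `I_(size s)]); last exact: card_image_le.
  apply: subset_card_le => _ [c cN <-].
  pose f : {ffun 'I_r' -> 'I_(2 * N).+1} := [ffun h => inord `|c h + N%:Z|].
  have fE h : (f h)%:Z - N%:Z = c h.
    have h1 : (`|c h| <= N)%N := cN h.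
    rewrite ffunE inordK; first by move: h1; move: (c h) => u; clear; lia.
    by move: h1; move: (c h) => u; clear; lia.
  have Fs : F f \in s by apply: map_f; rewrite mem_enum.
  exists (index (F f) s); first by rewrite /= index_mem.
  by rewrite nth_index // /F; apply: eq_bigr => h _; rewrite fE.
move=> x /Bg[c cm ->]; have [c' [c'N ->]] := rep c cm.
exists c' => //; apply: eq_bigr => h _ /=; rewrite -(mulrzr (g' h)); exact: mulrC.
Qed.

(** * From random variables to sign patterns *)

Section FiniteModel.
Variables (R : realType) (mu : R) (d : measure_display) (T : measurableType d).
Variable P : probability T R.

Lemma measure_bigsetU_le (I : Type) (s : seq I) (F : I -> set T) :
    (forall i, measurable (F i)) ->
  (P (\big[setU/set0]_(i <- s) F i) <= \sum_(i <- s) P (F i))%E.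
Proof.
move=> mF; elim: s => [|i s IH]; first by rewrite !big_nil measure0.
rewrite !big_cons; apply: le_trans (measureU2 _ _ _) _ => //.
  exact: bigsetU_measurable.
by rewrite leeD2l.
Qed.

Lemma measurable_rv_preimage (X : {RV P >-> R}) (B : set R) :
  measurable B -> measurable (X @^-1` B).
Proof. by move=> mB; rewrite -[_ @^-1` _]setTI; apply: measurable_funPT. Qed.

(** The three prescribed atoms already have total mass 1. *)
Lemma eta_law_support (X : {RV P >-> R}) : eta_law mu X ->
  P (\bigcap_(v in [set: 'I_3]) X @^-1` [set~ sgn3 R v]) = 0%E.
Proof.
case=> h1 hm1 h0.
have mX v : measurable (X @^-1` [set v]) by apply: measurable_rv_preimage; exact: measurable_set1.
have dis u v : u != v -> X @^-1` [set u] `&` X @^-1` [set v] = set0.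
  by move=> uv; apply/seteqP; split => // w [/= -> /eqP]; rewrite (negbTE uv).
have -> : \bigcap_(v in [set: 'I_3]) X @^-1` [set~ sgn3 R v] =
    ~` (X @^-1` [set 1] `|` X @^-1` [set -1] `|` X @^-1` [set 0]).
  apply/seteqP; split => w.
    move=> h [[]|] /= e.
    - by apply: (h (inord 2) I); rewrite /= e /sgn3 inordK //; lra.
    - by apply: (h (inord 0) I); rewrite /= e /sgn3 inordK //; lra.
    - by apply: (h (inord 1) I); rewrite /= e /sgn3 inordK //; lra.
  move=> h [[|[|[|//]]] v3] _ /= e; apply: h; rewrite /= e /sgn3 /=.
  - by left; right; lra.
  - by right; lra.
  - by left; left; lra.
rewrite probability_setC; last by apply: measurableU => //; apply: measurableU.
rewrite measureU //; last 2 first.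
- exact: measurableU.
- by rewrite setIUl !dis ?setU0 // ?oner_neq0 // oppr_eq0 oner_neq0.
rewrite measureU //; last by apply: dis; apply/eqP; lra.
have -> : (P (X @^-1` [set 1%R]) + P (X @^-1` [set (- 1)%R]) + P (X @^-1` [set 0%R]) = 1)%E.
  by rewrite h1 hm1 h0 -!EFinD; congr (_%:E); field.
by rewrite subee.
Qed.

Lemma eta_law_wt3 (X : {RV P >-> R}) v : eta_law mu X ->
  P (X @^-1` [set sgn3 R v]) = (wt3 mu v)%:E.
Proof.
case=> h1 hm1 h0; rewrite /sgn3 /wt3; case: v => [[|[|[|//]]] v3] /=.
- by rewrite sub0r hm1.
- by rewrite subrr h0.
- by rewrite (_ : 2 - 1 = 1 :> R) ?h1 //; lra.
Qed.

Definition joint_prob n (A : 'M[R]_n) (a : R) : R :=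
  \sum_(s : n.-tuple 'I_3) \sum_(t : n.-tuple 'I_3) wt mu s * wt mu t *
    (\sum_i \sum_j A i j * sgn3 R (tnth s i) * sgn3 R (tnth t j) == a)%:R.

(** Conditioning on [x]. The sign of [a] changes because [rho] starts the walk at its argument and
    asks for an end at 0. *)
Lemma joint_prob_rho n (A : 'M[R]_n) a : joint_prob A a =
  \sum_(s : n.-tuple 'I_3) wt mu s *
    rho mu (map (fun j => \sum_i A i j * sgn3 R (tnth s i)) (enum 'I_n)) (- a).
Proof.
apply: eq_bigr => s _; rewrite /rho -sum_wt_walk mulr_sumr; apply: eq_bigr => t _.
rewrite -mulrA; congr (_ * (_ * _%:R)); rewrite addrC subr_eq0 exchange_big /=.
congr (nat_of_bool (_ == _)); apply: eq_bigr => j _; rewrite mulr_suml.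
by apply: eq_bigr => i _.
Qed.

Lemma joint_prob_tr n (A : 'M[R]_n) a : joint_prob A^T a = joint_prob A a.
Proof.
rewrite /joint_prob exchange_big /=; apply: eq_bigr => s _; apply: eq_bigr => t _.
rewrite [wt mu t * _]mulrC; congr (_ * (_ == _)%:R); rewrite exchange_big /=.
by apply: eq_bigr => i _; apply: eq_bigr => j _; rewrite mxE mulrAC.
Qed.

(** Union bound: the event is covered by the null sets where some variable leaves -1, 0, 1, and by
    the cells with fixed signs that satisfy the equation, whose probabilities independence gives. *)
Lemma prob_le_joint_prob n (x y : 'I_n -> {RV P >-> R}) (A : 'M[R]_n) a :
  iid_eta mu x y ->
  (P [set w | (\sum_(i < n) \sum_(j < n) A i j * x i w * y j w = a)%R] <= (joint_prob A a)%:E)%E.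
Proof.
case=> lx ly ind; set E := [set w | _].
pose X (i : 'I_n + 'I_n) := match i with inl i => x i | inr j => y j end.
have lX i : eta_law mu (X i) by case: i.
pose B (p : n.-tuple 'I_3 * n.-tuple 'I_3) (i : 'I_n + 'I_n) : set R :=
  match i with inl i => [set sgn3 R (tnth p.1 i)] | inr j => [set sgn3 R (tnth p.2 j)] end.
have mB p i : measurable (B p i) by case: i => i; exact: measurable_set1.
pose cell p := \bigcap_(i in [set: 'I_n + 'I_n]) (X i @^-1` B p i).
have mcell p : measurable (cell p).
  apply: fin_bigcap_measurable => [|i _]; first exact: finite_finset.
  exact: measurable_rv_preimage.
have cellE p : P (cell p) = (wt mu p.1 * wt mu p.2)%:E.
  have -> : P (cell p) = (\prod_(i : 'I_n + 'I_n) P (X i @^-1` B p i))%E by apply: ind => i.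
  rewrite big_sumType /= EFinM /wt -!prodEFin; congr (_ * _)%E.
    by apply: eq_bigr => i _; rewrite eta_law_wt3.
  by apply: eq_bigr => i _; rewrite eta_law_wt3.
pose bad (i : 'I_n + 'I_n) := \bigcap_(v in [set: 'I_3]) X i @^-1` [set~ sgn3 R v].
have mbad i : measurable (bad i).
  apply: fin_bigcap_measurable => [|v _]; first exact: finite_finset.
  by apply: measurable_rv_preimage; apply: measurableC; exact: measurable_set1.
pose good (p : n.-tuple 'I_3 * n.-tuple 'I_3) :=
  \sum_i \sum_j A i j * sgn3 R (tnth p.1 i) * sgn3 R (tnth p.2 j) == a.
pose F p := if good p then cell p else set0.
have mF p : measurable (F p) by rewrite /F; case: ifP.
have mE : measurable E.
  have mf : measurable_fun setT (fun w => \sum_(i < n) \sum_(j < n) A i j * x i w * y j w).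
    apply: measurable_sum => i; apply: measurable_sum => j.
    do 2![apply: measurable_realfun.measurable_funM => //]; exact: measurable_cst.
  rewrite (_ : E = setT `&` (fun w => \sum_(i < n) \sum_(j < n) A i j * x i w * y j w) @^-1` [set a]).
    by apply: mf => //; exact: measurable_set1.
  by rewrite setTI.
have sub : E `<=` \big[setU/set0]_(i <- index_enum _) bad i `|` \big[setU/set0]_(p <- index_enum _) F p.
  move=> w Ew; have [[i bi]|nb] := pselect (exists i, bad i w).
    by left; rewrite -bigcup_seq; exists i => //=; rewrite mem_index_enum.
  right; have /choice[v vP] : forall i, exists v : 'I_3, X i w = sgn3 R v.
    move=> i; apply: contrapT => none; apply: nb; exists i => v _ /= e.
    by apply: none; exists v.
  pose p := ([tuple v (inl i) | i < n], [tuple v (inr i) | i < n]).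
  rewrite -bigcup_seq; exists p; rewrite /= ?mem_index_enum // /F.
  have -> : good p.
    rewrite /good; apply/eqP; rewrite -Ew; apply: eq_bigr => i _; apply: eq_bigr => j _.
    by rewrite !tnth_mktuple -(vP (inl i)) -(vP (inr j)).
  by move=> [i|i] _ /=; rewrite tnth_mktuple -vP.
apply: (@le_trans _ _ (P (\big[setU/set0]_(i <- index_enum _) bad i) +
    P (\big[setU/set0]_(p <- index_enum _) F p))%E).
  apply: le_trans (measureU2 _ _ _); rewrite ?le_measure ?inE //.
  - by apply: measurableU; apply: bigsetU_measurable.
  - exact: bigsetU_measurable.
  - exact: bigsetU_measurable.
rewrite -[leRHS]add0e; apply: leeD.
  apply: le_trans (measure_bigsetU_le _ mbad) _.
  by rewrite big1 // => i _; apply: eta_law_support.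
apply: le_trans (measure_bigsetU_le _ mF) _.
rewrite /joint_prob pair_big /= -sumEFin; apply: lee_sum => p _.
rewrite /F /good; case: ifP => _; first by rewrite cellE mulr1.
by rewrite measure0 mulr0.
Qed.

(** The factor 2 pays for passing from the supremum to one value [a]. *)
Lemma rho_b_joint_prob n (x y : 'I_n -> {RV P >-> R}) (A : 'M[R]_n) (p : R) :
  iid_eta mu x y -> 0 < p -> (p%:E <= rho_b x y A)%E ->
  exists a, p / 2 <= joint_prob A a.
Proof.
move=> iid p0 H.
have : ((p / 2)%:E < rho_b x y A)%E.
  by apply: lt_le_trans H; rewrite lte_fin; lra.
move=> /ereal_sup_gt[_ [a _ <-]] h; exists a; rewrite -lee_fin.
exact: le_trans (ltW h) (prob_le_joint_prob A a iid).
Qed.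

End FiniteModel.

(** * Rows and columns of [L A R] *)

Lemma exists_subset_card (T : finType) (S : {set T}) k : (k <= #|S|)%N ->
  exists2 S' : {set T}, S' \subset S & #|S'| = k.
Proof.
move=> kS; exists [set x in take k (enum S)].
  by apply/fintype.subsetP => x; rewrite inE => /mem_take; rewrite mem_enum.
by rewrite cardsE (card_uniqP _) ?take_uniq ?enum_uniq // size_takel // -cardE.
Qed.

Lemma mulmx_Rmx (R : realType) n (A : 'M[R]_n) (J J0 : {set 'I_n}) l ll i j :
    [disjoint J & J0]%B ->
  (A *m Rmx R J J0 l ll) i j =
  if j \in J then A i j *~ l + \sum_(h in J0) A i h *~ ll h j else A i j.
Proof.
move=> dis; rewrite mxE; case: ifP => jJ.
  have jJ0 : j \notin J0 by rewrite (disjointFr dis jJ).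
  rewrite (bigID (mem J0)) /= addrC; congr (_ + _).
    rewrite (bigD1 j) //= big1 ?addr0 => [|h /andP[hJ0 /negbTE hj]].
      by rewrite mxE jJ (negbTE jJ0) eqxx mulrzr.
    by rewrite mxE jJ (negbTE hJ0) hj mulr0.
  by apply: eq_bigr => h hJ0; rewrite mxE jJ hJ0 mulrzr.
rewrite (bigD1 j) //= big1 ?addr0 => [|h /negbTE hj]; rewrite mxE jJ.
  by rewrite eqxx mulr1.
by rewrite hj mulr0.
Qed.

Lemma tr_Rmx (R : realType) n (J J0 : {set 'I_n}) l ll :
  (Rmx R J J0 l ll)^T = Lmx R J J0 l (fun i j => ll j i).
Proof. by apply/matrixP => i j; rewrite !mxE [i == j]eq_sym. Qed.

Lemma tr_Lmx (R : realType) n (I I0 : {set 'I_n}) k kk :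
  (Lmx R I I0 k kk)^T = Rmx R I I0 k (fun i j => kk j i).
Proof. by rewrite -[RHS]trmxK tr_Rmx. Qed.

Lemma mulmx_Lmx (R : realType) n (A : 'M[R]_n) (I I0 : {set 'I_n}) k kk i j :
    [disjoint I & I0]%B ->
  (Lmx R I I0 k kk *m A) i j =
  if i \in I then A i j *~ k + \sum_(h in I0) A h j *~ kk i h else A i j.
Proof.
move=> dis; rewrite -[Lmx _ _ _ _ _ *m A]trmxK mxE trmx_mul tr_Lmx mulmx_Rmx // mxE.
by case: ifP => // _; congr (_ + _); apply: eq_bigr => h _; rewrite mxE.
Qed.

(** Row [i] of [L] with [i] in [I] multiplies the entry of [A R] by [k] and adds a combination of
    the entries indexed by [I0]. With those entries as extra generators one GAP serves every [i] in
    [S], inside [I] or not. *)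
Lemma column_small_gap (R : realType) (m n K D M Kf : nat) (A : 'M[R]_n)
    (I I0 J J0 S : {set 'I_n}) k l kk ll j :
    (2 <= m <= n)%N -> [disjoint I & I0]%B -> [disjoint J & J0]%B -> j \in J ->
    (`|k| <= m ^ K)%N -> (forall i h, (`|kk i h| <= m ^ K)%N) ->
    (#|I0| <= D)%N -> (#|~: S| <= M)%N ->
    (((2 * K + 2) * 2 ^ (K + D) + 2) * (K + D).+1 <= Kf)%N ->
    col_structured m K (fun i => A i j *~ l + \sum_(h in J0) A i h *~ ll h j) S ->
  exists S' : {set 'I_n}, #|S'| = (n - M)%N /\
    in_small_proper_gap Kf n
      [set (Lmx R I I0 k kk *m A *m Rmx R J J0 l ll) i j | i in [set` S']].
Proof.
move=> mn disI disJ jJ km kkm I0D SM KfE [r [g [rK gP]]].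
have [|S' S'S cS'] := @exists_subset_card _ S (n - M)%N.
  by have := cardsC S; rewrite card_ord; lia.
exists S'; split => //.
pose v i := A i j *~ l + \sum_(h in J0) A i h *~ ll h j; 
pose r' := (r + #|I0|)%N.
have r'K : (r' <= K + D)%N by rewrite leq_add.
pose g' (t : 'I_r') := match fintype.split t with inl h => g h | inr h => v (enum_val h) end.
apply: (small_proper_gap_of_generators (g := g') (k := (2 * K)%N) mn).
- by move: r'K KfE; move: (2 ^ (K + D))%N => u; clear; nia.
- apply: leq_trans KfE; apply: leq_mul; last exact: leqW.
  by rewrite leq_add2r leq_mul2l leq_pexp2l ?orbT.
move=> _ [i /= iS' <-]; have iS : i \in S by apply: (fintype.subsetP S'S).
have [c cm vE] := gP i iS.
have mK : (m ^ (2 * K) = m ^ K * m ^ K)%N by rewrite -expnD; congr (_ ^ _)%N; lia.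
have mK0 : (0 < m ^ K)%N by rewrite expn_gt0; case/andP: mn => /ltnW ->.
exists (fun t => match fintype.split t with
    inl h => if i \in I then c h * k else c h
  | inr h => if i \in I then kk i (enum_val h) else 0 end).
  move=> t; rewrite mK; case: (fintype.split t) => h; case: (i \in I) => //.
  - by rewrite abszM leq_mul.
  - by apply: leq_trans (cm h) _; rewrite leq_pmulr.
  - by apply: leq_trans (kkm _ _) _; rewrite leq_pmulr.
rewrite -mulmxA mulmx_Lmx // mulmx_Rmx // jJ -/(v i) big_split_ord /=.
have -> : \sum_(h in I0) (A *m Rmx R J J0 l ll) h j *~ kk i h =
    \sum_(t < #|I0|) v (enum_val t) *~ kk i (enum_val t).
  rewrite -(big_enum_val (fun h => v h *~ kk i h)); apply: eq_bigr => h _.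
  by rewrite mulmx_Rmx // jJ.
have E1 F : \sum_(t < r) g' (lshift #|I0| t) *~ (F (fintype.split (lshift #|I0| t))) =
    \sum_(t < r) g t *~ F (inl t).
  by apply: eq_bigr => t _; rewrite /g' (unsplitK (inl t)).
have E2 F : \sum_(t < #|I0|) g' (rshift r t) *~ (F (fintype.split (rshift r t))) =
    \sum_(t < #|I0|) v (enum_val t) *~ F (inr t).
  by apply: eq_bigr => t _; rewrite /g' (unsplitK (inr t)).
rewrite (E1 (fun p => match p with
    inl h => if i \in I then c h * k else c h
  | inr h => if i \in I then kk i (enum_val h) else 0 end)).
rewrite (E2 (fun p => match p with
    inl h => if i \in I then c h * k else c h
  | inr h => if i \in I then kk i (enum_val h) else 0 end)).
have -> : v i = \sum_h g h *~ c h := vE.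
case: ifP => iI; last by rewrite [X in _ + X]big1 ?addr0 // => t _; rewrite mulr0z.
by congr (_ + _); rewrite mulrz_suml; apply: eq_bigr => t _; rewrite mulrzA.
Qed.

(** The scale [m = 2 ^ s] is about [n ^ (eps / 2)]: exceptional sets of size [m ^ 2] fit into
    [n ^ eps], and [n] is polynomial in [m]. Hence the logarithm to base 4 in the choice of [s]. *)
Lemma power_scale (R : realType) (eps : R) : 0 < eps <= 1 -> exists e : nat, forall smin,
  exists n0 : nat, forall n, (n0 <= n)%N -> exists s : nat,
   [/\ (smin <= s)%N, ((2 ^ s) ^ 2 <= Num.truncn (n%:R `^ eps))%N, (n < (2 ^ s) ^ e)%N &
     (2 <= 2 ^ s <= n)%N].
Proof.
case/andP=> eps0 eps1; pose e0 := Num.bound eps^-1.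
have ee : 1 <= eps * e0%:R.
  by rewrite mulrC -ler_pdivrMr // div1r ltW // archi_boundP // invr_ge0 ltW.
exists (4 * e0)%N => smin; exists (4 ^ (smin.+1 * e0)).+1 => n n0.
have n1 : 1 <= n%:R :> R by rewrite ler1n; apply: leq_trans n0.
set t := Num.truncn _; pose s := trunc_log 4 t.
have t0 : (0 < t)%N by rewrite truncn_gt0; apply: le_trans (ler_powR n1 (ltW eps0)); rewrite powRr0.
have s1 : (4 ^ s <= t)%N by apply: trunc_logP.
have s2 : (t < 4 ^ s.+1)%N by apply: trunc_log_ltn.
have nt : n%:R `^ eps < (4 ^ s.+1)%:R :> R.
  by apply: lt_le_trans (truncnS_gt _) _; rewrite ler_nat.
have e00 : (0 < e0)%N.
  by rewrite lt0n; apply/eqP => E; move: ee; rewrite E mulr0 ler10.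
have ns : (n < 4 ^ (s.+1 * e0))%N.
  rewrite -(ltr_nat R) expnM natrX.
  apply: (@le_lt_trans _ _ ((n%:R `^ eps) ^+ e0)); last first.
    by rewrite ltr_pXn2r ?nnegrE ?powR_ge0 ?ler0n.
  rewrite -powR_mulrn ?powR_ge0 // -powRrM -[leLHS]powRr1 ?ler0n //.
  exact: ler_powR.
have ss : (smin.+1 <= s)%N.
  rewrite leqNgt; apply/negP => h.
  have : (4 ^ (s.+1 * e0) <= 4 ^ (smin.+1 * e0))%N by rewrite leq_exp2l // leq_mul2r h orbT.
  by move=> /(leq_trans ns)/ltnW; rewrite leqNgt n0.
have E4 k : (4 ^ k = 2 ^ (2 * k))%N by rewrite expnM.
have s0 : (0 < s)%N by apply: leq_trans ss.
exists s; split => //.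
- exact: ltnW.
- by rewrite -expnM mulnC -E4.
- apply: leq_trans ns _; rewrite E4 -expnM leq_exp2l //.
  by move: s0 e00; clear; nia.
rewrite -{1}[2%N]expn1 leq_exp2l // s0 /=.
apply: (@leq_trans t).
  by apply: leq_trans s1; rewrite E4 leq_exp2l // leq_pmull.
rewrite -(ler_nat R); apply: (@le_trans _ _ (n%:R `^ eps)); first by rewrite truncn_le powR_ge0.
by rewrite -[leRHS]powRr1 ?ler0n // ler_powR.
Qed.

(** * Combination of rows and columns *)

Theorem theorem7p8 (R : realType) (eps C : R)
    (heps : 0 < eps <= 1) (hC : 0 < C) :
  exists K0 : nat, forall mu : R, 0 < mu <= 1 ->
  exists K n0 : nat, forall n : nat, (n0 <= n)%N ->
  forall (d : measure_display) (T : measurableType d) (P : probability T R)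
    (x y : 'I_n -> {RV P >-> R}), iid_eta mu x y ->
  forall A : 'M[R]_n, ((n%:R `^ (- C))%:E <= rho_b x y A)%E ->
  exists (I0 J0 I J : {set 'I_n}) (k l : int) (kk ll : 'I_n -> 'I_n -> int),
    [/\ (#|I0| <= K0)%N /\ (#|J0| <= K0)%N,
        #|I| = size_minus n (3 * n%:R `^ eps) /\
        #|J| = size_minus n (3 * n%:R `^ eps),
        [disjoint I & I0]%B /\ [disjoint J & J0]%B,
        [/\ k != 0, l != 0, (`|k| <= n ^ K)%N & (`|l| <= n ^ K)%N] /\
        (forall i j, i \in I -> j \in I0 -> (`|kk i j| <= n ^ K)%N) /\
        (forall i j, i \in J0 -> j \in J -> (`|ll i j| <= n ^ K)%N) &
        let A' : 'M[R]_n := Lmx R I I0 k kk *m A *m Rmx R J J0 l ll in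
        (forall i, i \in I -> exists S : {set 'I_n},
           #|S| = size_minus n (n%:R `^ eps) /\
           in_small_proper_gap K n [set A' i j | j in [set` S]]) /\
        (forall j, j \in J -> exists S : {set 'I_n},
           #|S| = size_minus n (n%:R `^ eps) /\
           in_small_proper_gap K n [set A' i j | i in [set` S]])].
Proof.
have [e scale] := power_scale heps.
(* [n ^ C <= m ^ (e * C0)], and one more power of [m] covers the factor 2 of [rho_b_joint_prob].
   None of these constants involves [mu], so [D] can be given first. *)
pose C0 := Num.bound C; pose c1 := (e * C0).+1; pose D := (8 * c1.+1)%N.
exists D => mu hmu; have [K1 [s1 structure]] := @column_structure R c1 e mu hmu.
pose Kf := (((2 * K1 + 2) * 2 ^ (K1 + D) + 2) * (K1 + D).+1)%N.
have [n0 scale0] := scale (s1 + D)%N.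
exists (K1 + Kf)%N, n0 => n nn0 d T P x y iid A rhoA.
have [s [ss sM ns m2n]] := scale0 n nn0.
set M := Num.truncn _ in sM; pose m := (2 ^ s)%N.
have /andP[m2 mn] := m2n.
have n1 : 1 <= n%:R :> R by rewrite ler1n (leq_trans _ mn) // (leq_trans _ m2).
have nC0 : 0 < n%:R `^ (- C) :> R by rewrite powR_gt0 // (lt_le_trans ltr01).
have [a Ha] := rho_b_joint_prob iid nC0 rhoA.
have jp : 1 <= m%:R ^+ c1 * joint_prob mu A a.
  apply: (@le_trans _ _ (m%:R ^+ c1 * (n%:R `^ (- C) / 2))); last first.
    by rewrite ler_wpM2l // exprn_ge0 // ler0n.
  have h : 1 <= m%:R ^+ (e * C0) * n%:R `^ (- C) :> R.
    rewrite powRN ler_pdivlMr ?powR_gt0 ?(lt_le_trans ltr01) // mul1r.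
    apply: (@le_trans _ _ (n%:R ^+ C0)).
      rewrite -powR_mulrn ?ler0n // ler_powR // ltW // archi_boundP // ltW //.
    by rewrite exprM lerXn2r ?nnegrE ?exprn_ge0 ?ler0n // -natrX ler_nat ltnW.
  have m2R : 2 <= m%:R :> R by rewrite ler_nat.
  rewrite /c1 exprS; move: h m2R; clear.
  move: (m%:R : R) (m%:R ^+ _) (_ `^ _) => z X Y h z2.
  have -> : z * X * (Y / 2) = z / 2 * (X * Y) by ring.
  by nra.
have s1s : (s1 <= s)%N by apply: leq_trans ss; rewrite leq_addr.
have Dm : (D <= m ^ 2)%N.
  apply: (@leq_trans s); first by apply: leq_trans ss; rewrite leq_addl.
  by apply: (@leq_trans m); [rewrite ltnW // ltn_expl | rewrite -mulnn leq_pmulr // (leq_trans _ m2)].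
have side (B : 'M[R]_n) : 1 <= m%:R ^+ c1 * joint_prob mu B a ->
  exists (J0 J : {set 'I_n}) (q : nat) (ll : 'I_n -> 'I_n -> int),
    [/\ (#|J0| <= D)%N /\ (0 < q <= m ^ K1)%N,
        #|J| = size_minus n (3 * n%:R `^ eps) /\ [disjoint J & J0]%B,
        forall h j, (`|ll h j| <= m ^ K1)%N &
        forall j, j \in J -> exists2 S : {set 'I_n}, (#|~: S| <= M)%N &
          col_structured m K1 (fun i => B i j *~ q + \sum_(h in J0) B i h *~ ll h j) S].
  rewrite joint_prob_rho => /(structure s s1s n B _ ns)[J0 [good [q [ll [[J0D qK] cg llK H]]]]].
  (* At most [2 * m ^ 2] columns are not good and [J0] has at most [D <= m ^ 2] elements, together
     at most [3 * M]. *)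
  have [|J Jgood cJ] := @exists_subset_card _ (good :\: J0) (size_minus n (3 * n%:R `^ eps)).
    rewrite /size_minus; have : (3 * M <= Num.truncn (3 * n%:R `^ eps))%N.
      rewrite truncn_ge_nat ?mulr_ge0 ?powR_ge0 ?ler0n // natrM ler_wpM2l ?ler0n //.
      by rewrite truncn_le powR_ge0.
    have := cardsC good; rewrite card_ord.
    have := cardsID J0 good; have := subset_leq_card (finset.subsetIr good J0).
    move: cg Dm sM J0D; rewrite -/m; clear; lia.
  exists J0, J, q, ll; split => //.
    split => //; rewrite disjoint_subset; apply/fintype.subsetP => j /(fintype.subsetP Jgood).
    by rewrite !inE => /andP[].
  move=> j /(fintype.subsetP Jgood); rewrite inE => /andP[_ /H[S cS st]].
  by exists S => //; apply: leq_trans cS sM.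
have [J0 [J [l [ll [[J0D lK] [cJ disJ] llK HJ]]]]] := side A jp.
have jpT : 1 <= m%:R ^+ c1 * joint_prob mu A^T a by rewrite joint_prob_tr.
have [I0 [I [k [kk [[I0D kK] [cI disI] kkK HI]]]]] := side A^T jpT.
have mnK K' : (K' <= K1 -> m ^ K' <= n ^ (K1 + Kf))%N.
  move=> h; apply: (@leq_trans (n ^ K')%N); first by case: (K') => [//|K'']; rewrite leq_exp2r.
  by rewrite leq_pexp2l ?(leq_trans _ mn) ?(leq_trans _ m2) // (leq_trans h (leq_addr _ _)).
have KfK : (Kf <= K1 + Kf)%N by rewrite leq_addl.
exists I0, J0, I, J, k%:Z, l%:Z, (fun i h => kk h i), ll; split => //.
  have /andP[k0 kK'] := kK; have /andP[l0 lK'] := lK.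
  split; first by split; rewrite ?eqz_nat -?lt0n //; [apply: leq_trans kK' _ | apply: leq_trans lK' _]; apply: mnK.
  by split => i j _ _; [apply: leq_trans (kkK _ _) _ | apply: leq_trans (llK _ _) _]; apply: mnK.
(* Transposition exchanges [L] and [R], so the rows of [A'] are columns of a product of the same
   shape. *)
move=> A'; have trA' : A'^T = Lmx R J J0 l%:Z (fun j h => ll h j) *m A^T *m Rmx R I I0 k%:Z kk.
  by rewrite !trmx_mul tr_Lmx tr_Rmx mulmxA.
split => [i iI|j jJ].
  have [S cS st] := HI i iI.
  have /andP[_ lK'] := lK.
  have [S' [cS' H]] := column_small_gap (k := l%:Z) (kk := fun j h => ll h j) m2n disJ disI iI
     lK' (fun i h => llK h i) J0D cS KfK st.
  exists S'; split => //; move: H; congr in_small_proper_gap.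
  congr image; apply/funext => j.
  by rewrite -trA' mxE.
have [S cS st] := HJ j jJ; have /andP[_ kK'] := kK.
exact: (column_small_gap (k := k%:Z) (kk := fun i h => kk h i) m2n disI disJ jJ kK'
  (fun i h => kkK h i) I0D cS KfK st).
Qed.
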